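(* Let $x_1,x_2,\dots\in\mathbb R^p$ be covariate vectors and let $Y_1,Y_2,\dots$ be independent with $Y_i\in\{0,1\}$ and $\Pr\{Y_i=1\mid x_i\}=q_i=\exp(\beta_0'x_i)/\{1+\exp(\beta_0'x_i)\}$ for some $\beta_0\in\mathbb R^p$. Let $\hat\beta_n$ be the maximum likelihood estimator and $J_n=\sum_{i\le n}q_i(1-q_i)x_ix_i'$ (assumed invertible). Assume that the sequence $\lambda_n=\max_{i\le n}|J_n^{-1/2}x_i|$ is bounded, and that $$N_n(\delta)=\sum_{i\le n}q_i(1-q_i)\,x_i'J_n^{-1}x_i\,I\{|J_n^{-1/2}x_i|\ge\delta\}\to0\quad\text{for each }\delta>0.$$ Then $J_n^{1/2}(\hat\beta_n-\beta_0)\to_d N_p\{0,I_p\}$.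
   Context: $J_n^{1/2}$ is the symmetric square root of $J_n$ and $J_n^{-1/2}$ its inverse. $N_p\{0,I_p\}$ is the standard $p$-variate normal distribution. *)

(* Defs.v *)
From HB Require Import structures.
From mathcomp Require Import all_boot all_order all_algebra.
From mathcomp Require Import all_classical all_reals all_analysis.
Set Implicit Arguments. Unset Strict Implicit. Unset Printing Implicit Defensive.
Import Order.TTheory GRing.Theory Num.Theory.
Import numFieldNormedType.Exports.
Local Open Scope classical_set_scope.
Local Open Scope ring_scope.

Section defs.
Variable R : realType.

Definition dotv (p : nat) (u v : 'cV[R]_p) : R := (u^T *m v) ord0 ord0.

Definition eucl_norm (p : nat) (v : 'cV[R]_p) : R :=
  Num.sqrt (\sum_(i < p) v i ord0 ^+ 2).

Definition logistic (t : R) : R := expR t / (1 + expR t).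

Definition loglik (p : nat) (x : nat -> 'cV[R]_p) (n : nat)
    (beta : 'cV[R]_p) (y : nat -> R) : R :=
  \sum_(i < n) (y i * ln (logistic (dotv beta (x i)))
                + (1 - y i) * ln (1 - logistic (dotv beta (x i)))).

Definition is_sym_sqrt (p : nat) (S A : 'M[R]_p) : Prop :=
  S^T = S /\ (forall v : 'cV[R]_p, 0 <= dotv v (S *m v)) /\ S *m S = A.

Definition mutually_independent_rv d (T : measurableType d)
    (P : probability T R) (Y : nat -> T -> R) : Prop :=
  forall (s : seq nat) (B : nat -> set R), uniq s ->
    (forall i, measurable (B i)) ->
    P [set w | forall i, i \in s -> B i (Y i w)] =
    (\prod_(i <- s) P (Y i @^-1` B i))%E.

Fixpoint gauss_iter (k : nat) (g : (nat -> R) -> R) : (nat -> R) -> R :=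
  match k with
  | 0 => g
  | k'.+1 => fun z =>
      Rintegral (normal_prob 0 1) setT
        (fun t => gauss_iter k' g (fun j => if j == k' then t else z j))
  end.

(** expectation of f(Z) for Z ~ N_p{0, I_p} (density = product of the
    N(0,1) densities, integrated coordinatewise) *)
Definition std_normal_expect (p : nat) (f : 'cV[R]_p -> R) : R :=
  gauss_iter p (fun z => f (\col_(i < p) z i)) (fun _ => 0).

Definition cvg_dist_std_normal d (T : measurableType d) (P : probability T R)
    (p : nat) (Z : nat -> T -> 'cV[R]_p) : Prop :=
  forall f : 'cV[R]_p -> R, continuous f ->
    (exists M : R, forall z, `|f z| <= M) ->
    (fun n => fine ('E_P[f \o Z n])%E) @ \oo --> std_normal_expect f.

End defs.

(* Main.v *)
(** With [v_i = J_n^{-1/2} x_i], the log-likelihood at [beta_0 + J_n^{-1/2} h]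
    differs from that at [beta_0] by [h'U_n - |h|^2/2] up to an error of order
    [|h|^3 sum_i q_i (1 - q_i) |v_i|^3], where [U_n = sum_i (Y_i - q_i) v_i]; the
    cubic sum is at most [delta p + lambda_n N_n(delta)], hence tends to [0].  The
    log-likelihood being concave, once it is strictly smaller on a sphere around
    [U_n] than at [U_n], its maximiser exists and lies inside that sphere, so
    [J_n^{1/2} (betahat_n - beta_0)] is close to [U_n] wherever [U_n] is bounded.

    Lindeberg's argument, swapping one summand at a time, gives the limits of the
    means of [cos (phi + theta'U_n)].  They determine the limit law, because a
    bounded continuous function agrees up to [e] on a cube with a trigonometric
    polynomial having the same bound: Bernstein's polynomials composed with
    [u_j |-> sin (u_j / 2L)] give one, and their weights are again Bernoulli means.
    Outside the cube second moments control the error. *)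

Require Import Defs.
From HB Require Import structures.
From mathcomp Require Import all_boot all_order all_algebra.
From mathcomp Require Import all_classical all_reals all_analysis.
From mathcomp Require Import measurable_realfun ring lra.
Set Implicit Arguments.
Unset Strict Implicit.
Unset Printing Implicit Defensive.
Import Order.TTheory GRing.Theory Num.Theory.
Import numFieldNormedType.Exports.
Local Open Scope classical_set_scope.
Local Open Scope ring_scope.

(** * Taylor estimates *)

Section taylor_estimates.
Variable R : realType.
Implicit Types (f df g dg : R -> R) (a b t x : R).

Lemma is_derive_ge0_le f df a b : a <= b ->
  (forall x, a <= x <= b -> is_derive x 1 f (df x)) ->
  (forall x, a <= x <= b -> 0 <= df x) -> f a <= f b.
Proof.
move=> ab f_df df_ge0.
have [in_a in_b] : a \in `[a, b] /\ b \in `[a, b].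
  by rewrite !in_itv/= !lexx ab.
have sub x : x \in `]a, b[ -> a <= x <= b.
  by rewrite in_itv/= => /andP[ax xb]; rewrite !ltW.
apply: (@ger0_derive1_le_cc _ f a b) => // [x /sub/f_df[]//|x /sub x_ab|].
  by rewrite derive1E; have [_ ->] := f_df x x_ab; exact: df_ge0.
apply: derivable_within_continuous => x; rewrite in_itv/= => x_ab.
by have [] := f_df x x_ab.
Qed.

Lemma is_derive_continuous f df :
  (forall x : R, is_derive x 1 f (df x)) -> continuous f.
Proof.
move=> f_df x; apply/differentiable_continuous/derivable1_diffP.
by have [] := f_df x.
Qed.

Lemma normr_derive_le f df g dg t :
  (forall x, `|x| <= `|t| -> is_derive x 1 f (df x)) ->
  (forall x, 0 <= x <= `|t| -> is_derive x 1 g (dg x)) ->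
  (forall x, `|x| <= `|t| -> `|df x| <= dg `|x|) ->
  `|f t - f 0| <= g `|t| - g 0.
Proof.
wlog t_ge0 : f df t / 0 <= t.
  move=> nonneg_case f_df g_dg df_dg; have [t_ge0|t_lt0] := leP 0 t.
    exact: nonneg_case f_df g_dg df_dg.
  have := nonneg_case (f \o -%R) (fun x => - df (- x)) (- t).
  rewrite /= normrN opprK oppr0; apply=> // [|x xt|x xt].
  - by rewrite oppr_ge0 ltW.
  - have f_dfN : is_derive (- x) 1 f (df (- x)) by apply: f_df; rewrite normrN.
    have := is_derive1_comp f_dfN (is_deriveN (is_derive_id x (1 : R))).
    by rewrite mulrN1.
  - by rewrite normrN -[x in dg `|x|]opprK normrN df_dg// normrN.
rewrite (ger0_norm t_ge0) => f_df g_dg df_dg.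
have norm_itv x : 0 <= x <= t -> `|x| = x /\ `|x| <= t.
  by case/andP=> x_ge0 x_le_t; rewrite ger0_norm.
have mono (s : R) : `|s| = 1 -> g 0 + s * f 0 <= g t + s * f t.
  move=> s1; apply: (@is_derive_ge0_le (fun x => g x + s * f x)
    (fun x => dg x + s * df x)) => // x x_t; have [xE x_le_t] := norm_itv x x_t.
    have f' := f_df x x_le_t; have g' := g_dg x x_t.
    by apply: is_derive_eq.
  have : `|s * df x| <= dg x by rewrite normrM s1 mul1r -{2}xE df_dg.
  by rewrite ler_norml; lra.
have := mono 1 (normr1 _); have := mono (-1) (normrN1 _).
by rewrite ler_norml; lra.
Qed.

Lemma normr_cos_le1 x : `|cos x| <= 1.
Proof. by rewrite ler_norml cos_geN1 cos_le1. Qed.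

Lemma normr_sin_le1 x : `|sin x| <= 1.
Proof. by rewrite ler_norml sin_geN1 sin_le1. Qed.

Lemma ler_norm_sin x : `|sin x| <= `|x|.
Proof.
have := @normr_derive_le sin cos id (fun=> 1) x.
rewrite sin0 !subr0; apply=> // y _.
exact: normr_cos_le1.
Qed.

Lemma cos_taylor1 x : `|cos x - 1| <= x ^+ 2 / 2.
Proof.
have := @normr_derive_le cos (fun x => - sin x) (fun x => x ^+ 2 / 2) id x.
rewrite cos0 expr0n/= mul0r subr0 real_normK ?num_real//; apply=> // y _.
  by apply: is_derive_eq; rewrite /GRing.scale/=; field.
by rewrite normrN ler_norm_sin.
Qed.

Lemma sin_taylor2 x : `|sin x - x| <= `|x| ^+ 3 / 6.
Proof.
have := @normr_derive_le (fun x => sin x - x) (fun x => cos x - 1)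
  (fun x => x ^+ 3 / 6) (fun x => x ^+ 2 / 2) x.
rewrite sin0 expr0n/= mul0r !subr0; apply=> // y _.
  by apply: is_derive_eq; rewrite /GRing.scale/=; field.
by rewrite real_normK ?num_real// cos_taylor1.
Qed.

Lemma cos_taylor3 x : `|cos x - 1 + x ^+ 2 / 2| <= x ^+ 4 / 24.
Proof.
have := @normr_derive_le (fun x => cos x + x ^+ 2 / 2) (fun x => - (sin x - x))
  (fun x => x ^+ 4 / 24) (fun x => x ^+ 3 / 6) x.
have -> : x ^+ 4 = `|x| ^+ 4 by rewrite -normrX ger0_norm// exprn_even_ge0.
rewrite cos0 !expr0n/= !mul0r addr0 subr0 addrAC.
apply=> y _; last by rewrite normrN sin_taylor2.
  by apply: is_derive_eq; rewrite /GRing.scale/=; field.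
by apply: is_derive_eq; rewrite /GRing.scale/=; field.
Qed.

Lemma ler_norm_cosB a b : `|cos a - cos b| <= `|a - b|.
Proof.
have := @normr_derive_le (fun x => cos (b + x)) (fun x => - sin (b + x))
  id (fun=> 1) (a - b).
rewrite addr0 subr0 subrKC; apply=> // y _.
  by apply: is_derive_eq; rewrite /GRing.scale/=; ring.
by rewrite normrN normr_sin_le1.
Qed.

Lemma expRN_taylor1 x : 0 <= x -> `|expR (- x) - 1 + x| <= x ^+ 2 / 2.
Proof.
move=> x_ge0; pose f t : R := t ^+ 2 / 2 - t - expR (- t).
have : f 0 <= f x.
  apply: (@is_derive_ge0_le f (fun t => t - 1 + expR (- t))) => // y _.
    by apply: is_derive_eq; rewrite /GRing.scale/=; field.
  by have := expR_ge1Dx (- y); lra.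
rewrite /f oppr0 expR0; have := expR_ge1Dx (- x).
by rewrite ler_norml; have := sqr_ge0 x; lra.
Qed.

End taylor_estimates.

(** * One Bernoulli variable *)

Section bernoulli_variable.
Variable R : realType.
Implicit Types c q s t x : R.

Definition bernoulli_variance q : R := q * (1 - q).

Lemma bernoulli_variance_ge0 q : 0 <= q <= 1 -> 0 <= bernoulli_variance q.
Proof. by case/andP=> q0 q1; rewrite mulr_ge0// subr_ge0. Qed.

Lemma bernoulli_mean_cos q s : 0 <= q <= 1 ->
  `|q * cos ((1 - q) * s) + (1 - q) * cos ((0 - q) * s)
     - expR (- (bernoulli_variance q * s ^+ 2 / 2))|
  <= bernoulli_variance q * s ^+ 4.
Proof.
move=> q01; have [q0 q1] := andP q01; have v0 := bernoulli_variance_ge0 q01.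
have cos_success := cos_taylor3 ((1 - q) * s).
have cos_failure := cos_taylor3 ((0 - q) * s).
have expR_var : `|expR (- (bernoulli_variance q * s ^+ 2 / 2)) - 1
    + bernoulli_variance q * s ^+ 2 / 2|
    <= (bernoulli_variance q * s ^+ 2 / 2) ^+ 2 / 2.
  by apply: expRN_taylor1; rewrite divr_ge0// mulr_ge0 ?sqr_ge0.
have r0 : 0 <= 1 - q by rewrite subr_ge0.
have remainder : q * (((1 - q) * s) ^+ 4 / 24) + (1 - q) * (((0 - q) * s) ^+ 4 / 24)
    + (bernoulli_variance q * s ^+ 2 / 2) ^+ 2 / 2 <= bernoulli_variance q * s ^+ 4.
  have v1 : bernoulli_variance q <= 1 by rewrite /bernoulli_variance; nra.
  have q3 : q ^+ 3 <= 1 by rewrite expr_le1.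
  have r3 : (1 - q) ^+ 3 <= 1 by rewrite expr_le1//; lra.
  have vs4 : 0 <= bernoulli_variance q * s ^+ 4.
    by rewrite mulr_ge0// exprn_even_ge0.
  rewrite (_ : _ + _ = bernoulli_variance q * s ^+ 4
    * ((1 - q) ^+ 3 / 24 + q ^+ 3 / 24 + bernoulli_variance q / 8)); last first.
    by rewrite /bernoulli_variance; field.
  by rewrite -[leRHS]mulr1 ler_wpM2l//; lra.
apply: le_trans remainder.
set a := cos _ in cos_success *; set b := cos _ in cos_failure *.
set e := expR _ in expR_var *.
rewrite (_ : _ - e = q * (a - 1 + ((1 - q) * s) ^+ 2 / 2)
  + (1 - q) * (b - 1 + ((0 - q) * s) ^+ 2 / 2)
  - (e - 1 + bernoulli_variance q * s ^+ 2 / 2)); last first.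
  by rewrite /bernoulli_variance; field.
apply: le_trans (ler_normB _ _) (lerD _ expR_var).
apply: le_trans (ler_normD _ _) (lerD _ _).
  by rewrite normrM ger0_norm// ler_wpM2l.
by rewrite normrM ger0_norm// ler_wpM2l.
Qed.

Lemma bernoulli_mean_sin q s : 0 <= q <= 1 ->
  `|q * sin ((1 - q) * s) + (1 - q) * sin ((0 - q) * s)|
  <= bernoulli_variance q * `|s| ^+ 3.
Proof.
move=> q01; have [q0 q1] := andP q01; have v0 := bernoulli_variance_ge0 q01.
have sin_success := sin_taylor2 ((1 - q) * s).
have sin_failure := sin_taylor2 ((0 - q) * s).
have r0 : 0 <= 1 - q by rewrite subr_ge0.
rewrite (_ : q * _ + _ = q * (sin ((1 - q) * s) - (1 - q) * s)
  + (1 - q) * (sin ((0 - q) * s) - (0 - q) * s)); last by ring.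
apply: le_trans (ler_normD _ _) _.
rewrite !normrM (ger0_norm q0) (ger0_norm r0).
apply: le_trans (lerD (ler_wpM2l q0 sin_success) (ler_wpM2l r0 sin_failure)) _.
rewrite !normrM sub0r normrN (ger0_norm q0) (ger0_norm r0).
rewrite (_ : _ + _ = bernoulli_variance q * `|s| ^+ 3
  * ((1 - q) ^+ 2 / 6 + q ^+ 2 / 6)); last by rewrite /bernoulli_variance; field.
have q2 : q ^+ 2 <= 1 by rewrite expr_le1.
have r2 : (1 - q) ^+ 2 <= 1 by rewrite expr_le1//; lra.
rewrite -[leRHS]mulr1 ler_wpM2l//; last lra.
by rewrite mulr_ge0// exprn_ge0.
Qed.

Lemma bernoulli_mean_cos_shift q c s : 0 <= q <= 1 ->
  `|q * cos (c + (1 - q) * s) + (1 - q) * cos (c + (0 - q) * s)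
     - expR (- (bernoulli_variance q * s ^+ 2 / 2)) * cos c|
  <= bernoulli_variance q * s ^+ 2 * (`|s| + s ^+ 2).
Proof.
move=> q01; have mean_cos := bernoulli_mean_cos s q01.
have mean_sin := bernoulli_mean_sin s q01.
rewrite !cosD; set e := expR _ in mean_cos *.
rewrite (_ : _ - _ =
  cos c * (q * cos ((1 - q) * s) + (1 - q) * cos ((0 - q) * s) - e)
  - sin c * (q * sin ((1 - q) * s) + (1 - q) * sin ((0 - q) * s))); last by ring.
rewrite [leRHS](_ : _ = bernoulli_variance q * s ^+ 4
  + bernoulli_variance q * `|s| ^+ 3); last first.
  by rewrite (exprM s 2 2) -(real_normK (num_real s)); ring.
apply: le_trans (ler_normB _ _) (lerD _ _); rewrite normrM.
  by apply: le_trans mean_cos; rewrite ler_piMl// normr_cos_le1.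
by apply: le_trans mean_sin; rewrite ler_piMl// normr_sin_le1.
Qed.

Definition bernoulli_mgf q t : R := 1 - q + q * expR t.

Definition bernoulli_tilt q t : R := q * expR t / bernoulli_mgf q t.

Lemma bernoulli_mgf_gt0 q t : 0 <= q <= 1 -> 0 < bernoulli_mgf q t.
Proof.
rewrite /bernoulli_mgf => /andP[q0 q1]; have := expR_gt0 t => et.
by have [->|/eqP q_neq1] := eqVneq q 1; nra.
Qed.

Lemma bernoulli_mgf0 q : bernoulli_mgf q 0 = 1.
Proof. by rewrite /bernoulli_mgf expR0 mulr1 subrK. Qed.

Lemma bernoulli_tilt0 q : bernoulli_tilt q 0 = q.
Proof. by rewrite /bernoulli_tilt bernoulli_mgf0 expR0 divr1 mulr1. Qed.

Lemma bernoulli_tilt01 q t : 0 <= q <= 1 -> 0 <= bernoulli_tilt q t <= 1.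
Proof.
move=> q01; have mgf0 := bernoulli_mgf_gt0 t q01; have [q0 q1] := andP q01.
rewrite divr_ge0 ?mulr_ge0 ?expR_ge0 ?(ltW mgf0)//=.
by rewrite ler_pdivrMr// mul1r lerDr subr_ge0.
Qed.

Lemma bernoulli_mgf_ge_expR q t : 0 <= q <= 1 -> expR (q * t) <= bernoulli_mgf q t.
Proof.
case/andP=> q0 q1; have := convex_expR (Itv01 q0 q1) t 0.
by rewrite !convRE/= !mulr0 addr0 expR0 mulr1 addrC.
Qed.

(* Tilting by [s] is again a Bernoulli law, so the tangent at [s] is the bound
   [bernoulli_mgf_ge_expR] for the tilted law. *)
Lemma ln_bernoulli_mgf_ge_tangent q s t : 0 <= q <= 1 ->
  ln (bernoulli_mgf q s) + bernoulli_tilt q s * (t - s) <= ln (bernoulli_mgf q t).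
Proof.
move=> q01; have s0 := bernoulli_mgf_gt0 s q01.
have tilt01 := bernoulli_tilt01 s q01.
have -> : bernoulli_mgf q t =
    bernoulli_mgf q s * bernoulli_mgf (bernoulli_tilt q s) (t - s).
  rewrite {3}/bernoulli_mgf expRB mulrDr mulrBr mulr1 mulrA.
  rewrite [bernoulli_mgf q s * _]mulrC divfK ?gt_eqF// /bernoulli_mgf.
  by field; rewrite gt_eqF// expR_gt0.
rewrite lnM ?posrE ?bernoulli_mgf_gt0// lerD2l.
rewrite -[leLHS]expRK ler_ln ?posrE ?expR_gt0 ?bernoulli_mgf_gt0//.
exact: bernoulli_mgf_ge_expR.
Qed.

Lemma is_derive_bernoulli_mgf q t :
  is_derive t 1 (bernoulli_mgf q) (q * expR t).
Proof. by apply: is_derive_eq; rewrite /GRing.scale/=; ring. Qed.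

Lemma is_derive_ln_bernoulli_mgf q t : 0 <= q <= 1 ->
  is_derive t 1 (fun t => ln (bernoulli_mgf q t)) (bernoulli_tilt q t).
Proof.
move=> q01; rewrite /bernoulli_tilt mulrC.
exact: is_derive1_comp (is_derive1_ln (bernoulli_mgf_gt0 t q01))
  (is_derive_bernoulli_mgf q t).
Qed.

Lemma is_derive_bernoulli_tilt q t : 0 <= q <= 1 ->
  is_derive t 1 (bernoulli_tilt q)
    (bernoulli_variance q * (expR t / bernoulli_mgf q t ^+ 2)).
Proof.
move=> q01.
have mgf_neq0 : bernoulli_mgf q t != 0 by rewrite gt_eqF ?bernoulli_mgf_gt0.
have mgf_derive := is_derive_bernoulli_mgf q t.
have inv_derive : is_derive t 1 (fun t => (bernoulli_mgf q t)^-1)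
    (- (bernoulli_mgf q t) ^- 2 * (q * expR t)) by exact: is_deriveV.
rewrite /bernoulli_tilt; apply: is_derive_eq.
move: mgf_neq0; rewrite /GRing.scale/= /bernoulli_variance /bernoulli_mgf.
by move=> mgf_neq0; field.
Qed.

Lemma expR_div_bernoulli_mgf_sqr q t : 0 <= q <= 1 ->
  expR (- `|t|) <= expR t / bernoulli_mgf q t ^+ 2 <= expR `|t|.
Proof.
move=> q01; have [q0 q1] := andP q01; have mgf0 := bernoulli_mgf_gt0 t q01.
rewrite ler_pdivlMr ?ler_pdivrMr ?exprn_gt0//.
have [t0|/ltW t0] := leP 0 t.
  have et : 1 <= expR t by rewrite -expR0 ler_expR.
  have [le1_mgf mgf_le] : 1 <= bernoulli_mgf q t /\ bernoulli_mgf q t <= expR t.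
    by rewrite /bernoulli_mgf; split; nra.
  rewrite (ger0_norm t0) expRN ler_pdivrMl ?expR_gt0//.
  rewrite ler_peMr ?expR_ge0 ?exprn_ege1//=.
  by rewrite -expr2 lerXn2r// nnegrE ?expR_ge0// ltW.
have et : expR t <= 1 by rewrite -expR0 ler_expR.
have [mgf_le1 le_mgf] : bernoulli_mgf q t <= 1 /\ expR t <= bernoulli_mgf q t.
  by rewrite /bernoulli_mgf; have := expR_gt0 t; split; nra.
rewrite (ler0_norm t0) opprK expRN ler_piMr ?expR_ge0 ?exprn_ile1 ?(ltW mgf0)//=.
by rewrite ler_pdivlMl ?expR_gt0// -expr2 lerXn2r// nnegrE ?expR_ge0// ltW.
Qed.

Lemma bernoulli_tilt_taylor1 q t : 0 <= q <= 1 ->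
  `|bernoulli_tilt q t - q - bernoulli_variance q * t|
  <= bernoulli_variance q * expR `|t| * `|t| ^+ 2 / 2.
Proof.
move=> q01; have v0 := bernoulli_variance_ge0 q01.
have := @normr_derive_le _ (fun x => bernoulli_tilt q x - bernoulli_variance q * x)
  (fun x => bernoulli_variance q * (expR x / bernoulli_mgf q x ^+ 2 - 1))
  (fun x => bernoulli_variance q * expR `|t| * x ^+ 2 / 2)
  (fun x => bernoulli_variance q * expR `|t| * x) t.
rewrite bernoulli_tilt0 expr0n/= !(mulr0, mul0r) !subr0 addrAC.
apply=> x xt.
- have tilt_derive := is_derive_bernoulli_tilt x q01.
  by apply: is_derive_eq; rewrite /GRing.scale/= /bernoulli_mgf; ring.
- by apply: is_derive_eq; rewrite /GRing.scale/=; field.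
rewrite normrM (ger0_norm v0) -mulrA ler_wpM2l//.
have [lb ub] := andP (expR_div_bernoulli_mgf_sqr x q01).
have x0 := normr_ge0 x; have ex1 := expR_ge1Dx (- `|x|).
have ex : expR `|x| <= expR `|t| by rewrite ler_expR.
have et : 1 <= expR `|t| by rewrite -expR0 ler_expR.
have exN : (1 - `|x|) * expR `|x| <= 1.
  by rewrite -ler_pdivlMr ?expR_gt0// mul1r -expRN.
by rewrite ler_norml /bernoulli_mgf in lb ub *; nra.
Qed.

Lemma ln_bernoulli_mgf_taylor2 q t : 0 <= q <= 1 ->
  `|ln (bernoulli_mgf q t) - q * t - bernoulli_variance q * t ^+ 2 / 2|
  <= bernoulli_variance q * expR `|t| * `|t| ^+ 3.
Proof.
move=> q01; have v0 := bernoulli_variance_ge0 q01.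
have := @normr_derive_le _
  (fun x => ln (bernoulli_mgf q x) - q * x - bernoulli_variance q * x ^+ 2 / 2)
  (fun x => bernoulli_tilt q x - q - bernoulli_variance q * x)
  (fun x => bernoulli_variance q * expR `|t| * x ^+ 3 / 6)
  (fun x => bernoulli_variance q * expR `|t| * x ^+ 2 / 2) t.
rewrite bernoulli_mgf0 ln1 !expr0n/= !(mulr0, mul0r) !subr0.
move=> le_rem; apply: le_trans (le_rem _ _ _) _ => [x _|x _|x xt|].
- have ln_derive := is_derive_ln_bernoulli_mgf x q01.
  by apply: is_derive_eq; rewrite /GRing.scale/=; field.
- by apply: is_derive_eq; rewrite /GRing.scale/=; field.
- apply: le_trans (bernoulli_tilt_taylor1 x q01) _.
  by rewrite !ler_wpM2r ?sqr_ge0 ?invr_ge0// ler_wpM2l// ler_expR.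
by rewrite ler_piMr ?invf_le1 ?ler1n// mulr_ge0 ?exprn_ge0// mulr_ge0 ?expR_ge0.
Qed.

End bernoulli_variable.

(** * Means over independent Bernoulli variables *)

Section bern_mean.
Variable R : realType.
Implicit Types (q s y z : nat -> R) (G H c : (nat -> R) -> R) (n k : nat).

Definition update y k (t : R) : nat -> R := fun j => if j == k then t else y j.

Lemma update_same y k t : update y k t k = t.
Proof. by rewrite /update eqxx. Qed.

Fixpoint bern_mean q n G : (nat -> R) -> R :=
  match n with
  | 0 => G
  | k.+1 => fun y => q k * bern_mean q k G (update y k 1)
                     + (1 - q k) * bern_mean q k G (update y k 0)
  end.

Lemma eq_bern_mean q n G H y : G =1 H -> bern_mean q n G y = bern_mean q n H y.
Proof. by move=> GH; elim: n y => [|n IHn] y /=; rewrite ?GH// !IHn. Qed.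

Lemma bern_mean_cst q n (a : R) y : bern_mean q n (fun=> a) y = a.
Proof. by elim: n y => [//|n IHn] y /=; rewrite !IHn; ring. Qed.

Lemma bern_meanD q n G H y :
  bern_mean q n (fun z => G z + H z) y = bern_mean q n G y + bern_mean q n H y.
Proof. by elim: n y => [//|n IHn] y /=; rewrite !IHn; ring. Qed.

Lemma bern_meanZ q n (a : R) G y :
  bern_mean q n (fun z => a * G z) y = a * bern_mean q n G y.
Proof. by elim: n y => [//|n IHn] y /=; rewrite !IHn; ring. Qed.

Lemma bern_mean_sum q n (I : Type) (r : seq I) (F : I -> (nat -> R) -> R) y :
  bern_mean q n (fun z => \sum_(i <- r) F i z) y =
  \sum_(i <- r) bern_mean q n (F i) y.
Proof.
elim: r => [|i r IHr].
  by under eq_bern_mean do rewrite big_nil; rewrite bern_mean_cst big_nil.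
by under eq_bern_mean do rewrite big_cons; rewrite bern_meanD IHr big_cons.
Qed.

Lemma le_bern_mean q n G H y : (forall i, 0 <= q i <= 1) ->
  (forall z, G z <= H z) -> bern_mean q n G y <= bern_mean q n H y.
Proof.
move=> q01 GH; elim: n y => [//|n IHn] y /=; have /andP[q0 q1] := q01 n.
by apply: lerD; apply: ler_wpM2l; rewrite ?subr_ge0.
Qed.

Lemma ler_norm_bern_mean q n G H y : (forall i, 0 <= q i <= 1) ->
  (forall z, `|G z| <= H z) -> `|bern_mean q n G y| <= bern_mean q n H y.
Proof.
move=> q01 GH; rewrite ler_norml -mulN1r -bern_meanZ.
apply/andP; split; apply: le_bern_mean => // z.
  by have := GH z; rewrite ler_norml; lra.
by have := GH z; rewrite ler_norml; lra.
Qed.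

Lemma bern_meanB_cst q n G (a : R) y :
  bern_mean q n (fun z => G z - a) y = bern_mean q n G y - a.
Proof. by rewrite bern_meanD bern_mean_cst. Qed.

Definition depends_above k G :=
  forall y z, (forall j, (k <= j)%N -> y j = z j) -> G y = G z.

Lemma depends_above_update k G y t : depends_above k.+1 G -> G (update y k t) = G y.
Proof. by apply=> j kj; rewrite /update gtn_eqF. Qed.

Lemma depends_aboveD k c (a b : R) : depends_above k.+1 c ->
  depends_above k (fun y => c y + (y k - a) * b).
Proof. by move=> hc y z yz; rewrite (hc y z) ?yz// => j kj; exact/yz/ltnW. Qed.

Definition centered_sum q s n y : R := \sum_(i < n) (y i - q i) * s i.

Definition centered_sum_variance q s n : R :=
  \sum_(i < n) bernoulli_variance (q i) * s i ^+ 2.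

(* Revealing the last coordinate moves its term into the offset [c]. *)
Lemma bern_mean_centered_sumS q s n (F : R -> R) c y :
  bern_mean q n (fun z => F (c z + centered_sum q s n.+1 z)) y =
  bern_mean q n (fun z => F (c z + (z n - q n) * s n + centered_sum q s n z)) y.
Proof.
apply: eq_bern_mean => z; congr F.
by rewrite /centered_sum big_ord_recr/= addrCA addrC.
Qed.

Lemma bern_mean_centered_sum_sqr q s n c y : depends_above n c ->
  bern_mean q n (fun y => (c y + centered_sum q s n y) ^+ 2) y =
  c y ^+ 2 + centered_sum_variance q s n.
Proof.
elim: n c y => [|n IHn] c y c_above /=.
  by rewrite /centered_sum /centered_sum_variance !big_ord0 !addr0.
rewrite !(bern_mean_centered_sumS _ _ _ (fun t => t ^+ 2)).
rewrite !(IHn _ _ (depends_aboveD _ _ c_above)) !(depends_above_update _ _ c_above).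
rewrite !update_same /centered_sum_variance big_ord_recr/=.
by rewrite /bernoulli_variance; ring.
Qed.

Lemma bern_mean_cos_centered_sum q s n c y :
  (forall i, 0 <= q i <= 1) -> depends_above n c ->
  `|bern_mean q n (fun y => cos (c y + centered_sum q s n y)) y
     - expR (- centered_sum_variance q s n / 2) * cos (c y)|
  <= \sum_(i < n) bernoulli_variance (q i) * s i ^+ 2 * (`|s i| + s i ^+ 2).
Proof.
move=> q01; elim: n c y => [|n IHn] c y c_above.
  rewrite /= /centered_sum /centered_sum_variance !big_ord0.
  by rewrite oppr0 mul0r expR0 mul1r addr0 subrr normr0.
have [q0 q1] := andP (q01 n); have r0 : 0 <= 1 - q n by rewrite subr_ge0.
set V := centered_sum_variance q s n.
have V0 : 0 <= V.
  by apply: sumr_ge0 => i _; rewrite mulr_ge0 ?sqr_ge0 ?bernoulli_variance_ge0.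
set e := expR (- V / 2).
have e0 : 0 <= e by exact: expR_ge0.
have e1 : e <= 1 by rewrite /e -expR0 ler_expR mulNr oppr_le0 divr_ge0.
set rest := \sum_(i < n) _ in IHn.
pose mean b :=
  bern_mean q n (fun z => cos (c z + centered_sum q s n.+1 z)) (update y n b).
have IH b : `|mean b - e * cos (c y + (b - q n) * s n)| <= rest.
  have := IHn _ (update y n b) (depends_aboveD (q n) (s n) c_above).
  rewrite update_same (depends_above_update _ _ c_above).
  by rewrite -(bern_mean_centered_sumS _ _ _ cos).
rewrite /= -/(mean 1) -/(mean 0) /centered_sum_variance !big_ord_recr/=.
rewrite -/(centered_sum_variance q s n) -/V -/rest.
have swap := bernoulli_mean_cos_shift (c y) (s n) (q01 n).
rewrite (_ : - (V + _) / 2 = - V / 2 + - (bernoulli_variance (q n) * s n ^+ 2 / 2));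
  last by ring.
rewrite expRD -/e.
move: (IH 1) (IH 0) swap; set C1 := cos (c y + (1 - q n) * s n).
set C0 := cos (c y + (0 - q n) * s n); set g := expR _ => IH1 IH0 swap.
rewrite (_ : _ - _ = q n * (mean 1 - e * C1) + (1 - q n) * (mean 0 - e * C0)
  + e * (q n * C1 + (1 - q n) * C0 - g * cos (c y))); last by ring.
apply: le_trans (ler_normD _ _) (lerD _ _).
  apply: le_trans (ler_normD _ _) _; rewrite !normrM (ger0_norm q0) (ger0_norm r0).
  by apply: le_trans (lerD (ler_wpM2l q0 IH1) (ler_wpM2l r0 IH0)) _; lra.
by rewrite normrM (ger0_norm e0); apply: le_trans swap; rewrite ler_piMl.
Qed.

End bern_mean.

(** * Euclidean vectors and trigonometric polynomials *)

Section euclidean.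
Variables (R : realType) (p : nat).
Implicit Types (u v w : 'cV[R]_p) (a : R).

Lemma dotvE u v : dotv u v = \sum_(i < p) u i ord0 * v i ord0.
Proof. by rewrite /dotv mxE; apply: eq_bigr => i _; rewrite mxE. Qed.

Lemma dotvC u v : dotv u v = dotv v u.
Proof. by rewrite !dotvE; apply: eq_bigr => i _; rewrite mulrC. Qed.

Lemma dotvDl u v w : dotv (u + v) w = dotv u w + dotv v w.
Proof. by rewrite /dotv linearD/= mulmxDl mxE. Qed.

Lemma dotvZl a u v : dotv (a *: u) v = a * dotv u v.
Proof. by rewrite /dotv linearZ/= -scalemxAl mxE. Qed.

Lemma dotvNl u v : dotv (- u) v = - dotv u v.
Proof. by rewrite -scaleN1r dotvZl mulN1r. Qed.

Lemma dotvBl u v w : dotv (u - v) w = dotv u w - dotv v w.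
Proof. by rewrite dotvDl dotvNl. Qed.

Lemma dotv0l v : dotv 0 v = 0.
Proof. by rewrite /dotv trmx0 mul0mx mxE. Qed.

Lemma dotvDr u v w : dotv u (v + w) = dotv u v + dotv u w.
Proof. by rewrite dotvC dotvDl !(dotvC _ u). Qed.

Lemma dotvZr a u v : dotv u (a *: v) = a * dotv u v.
Proof. by rewrite dotvC dotvZl dotvC. Qed.

Lemma dotvBr u v w : dotv u (v - w) = dotv u v - dotv u w.
Proof. by rewrite dotvC dotvBl !(dotvC _ u). Qed.

Lemma dotv_sumr (I : Type) (r : seq I) (F : I -> 'cV[R]_p) u :
  dotv u (\sum_(i <- r) F i) = \sum_(i <- r) dotv u (F i).
Proof.
elim/big_rec2: _ => [|i b c _ <-]; first by rewrite dotvC dotv0l.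
by rewrite dotvDr.
Qed.

Lemma dotv_mulmx (A : 'M[R]_p) u v : dotv (A *m u) v = dotv u (A^T *m v).
Proof. by rewrite /dotv trmx_mul mulmxA. Qed.

Lemma dotv_delta_mx j u : dotv (delta_mx j ord0) u = u j ord0.
Proof.
rewrite dotvE (bigD1 j)//= big1 ?addr0 => [|i ij].
  by rewrite mxE !eqxx mul1r.
by rewrite mxE (negbTE ij) mul0r.
Qed.

Lemma dotv_delta_mx_id (j : 'I_p) :
  dotv (delta_mx j ord0) (delta_mx j ord0 : 'cV[R]_p) = 1.
Proof. by rewrite dotv_delta_mx mxE !eqxx. Qed.

Lemma dotv_ge0 u : 0 <= dotv u u.
Proof. by rewrite dotvE; apply: sumr_ge0 => i _; rewrite -expr2 sqr_ge0. Qed.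

Lemma eucl_norm_ge0 u : 0 <= eucl_norm u.
Proof. exact: sqrtr_ge0. Qed.

Lemma eucl_norm_sqr u : eucl_norm u ^+ 2 = dotv u u.
Proof.
rewrite sqr_sqrtr ?dotvE; first by apply: eq_bigr => i _; rewrite expr2.
by apply: sumr_ge0 => i _; exact: sqr_ge0.
Qed.

Lemma ler_coord_eucl_norm u i : `|u i ord0| <= eucl_norm u.
Proof.
rewrite -ler_sqr ?nnegrE ?eucl_norm_ge0// eucl_norm_sqr real_normK ?num_real//.
rewrite dotvE (bigD1 i)//= -expr2 lerDl sumr_ge0// => j _.
by rewrite -expr2 sqr_ge0.
Qed.

Lemma eucl_norm0_eq0 u : eucl_norm u = 0 -> u = 0.
Proof.
move=> u0; apply/matrixP => i j; rewrite ord1 mxE; apply/eqP.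
by rewrite -normr_le0 -u0 ler_coord_eucl_norm.
Qed.

Lemma cauchy_schwarz u v : `|dotv u v| <= eucl_norm u * eucl_norm v.
Proof.
have [/eucl_norm0_eq0 ->|v_neq0] := eqVneq (eucl_norm v) 0.
  by rewrite dotvC dotv0l normr0 mulr_ge0 ?eucl_norm_ge0.
rewrite -ler_sqr ?nnegrE ?mulr_ge0 ?eucl_norm_ge0//.
rewrite exprMn real_normK ?num_real//.
have v_gt0 : 0 < eucl_norm v ^+ 2.
  by rewrite exprn_gt0// lt_neqAle eq_sym v_neq0 eucl_norm_ge0.
have := dotv_ge0 (dotv v v *: u - dotv u v *: v).
rewrite dotvBl !dotvBr !dotvZl !dotvZr (dotvC v u) -!eucl_norm_sqr.
rewrite -subr_ge0 -(pmulr_rge0 _ v_gt0) => /le_trans; apply.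
by rewrite le_eqVlt; apply/orP; left; apply/eqP; ring.
Qed.

Lemma eucl_normZ a u : eucl_norm (a *: u) = `|a| * eucl_norm u.
Proof.
apply/eqP; rewrite -(@eqrXn2 _ 2) ?mulr_ge0 ?eucl_norm_ge0//.
by rewrite exprMn !eucl_norm_sqr dotvZl dotvZr real_normK ?num_real// expr2 mulrA.
Qed.

Lemma ler_eucl_normD u v : eucl_norm (u + v) <= eucl_norm u + eucl_norm v.
Proof.
rewrite -ler_sqr ?nnegrE ?addr_ge0 ?eucl_norm_ge0//.
rewrite sqrrD !eucl_norm_sqr dotvDl !dotvDr (dotvC v u).
have := cauchy_schwarz u v; rewrite ler_norml; lra.
Qed.

End euclidean.

Section trigonometric_polynomials.
Variables (R : realType) (p : nat).

Record trig_term := TrigTerm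
  { amplitude : R; frequency : 'cV[R]_p; phase : R }.

Implicit Types (l : seq trig_term) (u w : 'cV[R]_p) (g h : 'cV[R]_p -> R).

Definition trig_eval l u : R :=
  \sum_(a <- l) amplitude a * cos (phase a + dotv (frequency a) u).

Lemma trig_eval_lipschitz l u w : `|trig_eval l u - trig_eval l w| <=
  (\sum_(a <- l) `|amplitude a| * eucl_norm (frequency a)) * eucl_norm (u - w).
Proof.
rewrite /trig_eval -sumrB mulr_suml; apply: le_trans (ler_norm_sum _ _ _) _.
apply: ler_sum => a _; rewrite -mulrBr normrM -mulrA ler_wpM2l//.
apply: le_trans (ler_norm_cosB _ _) _.
by rewrite opprD addrACA subrr add0r -dotvBr cauchy_schwarz.
Qed.

Definition is_trig g := exists l, g =1 trig_eval l.

Lemma eq_is_trig g h : g =1 h -> is_trig g -> is_trig h.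
Proof. by move=> gh [l gl]; exists l => u; rewrite -gh. Qed.

Lemma is_trig_cst (c : R) : is_trig (fun=> c).
Proof.
exists [:: TrigTerm c 0 0] => u.
by rewrite /trig_eval big_seq1/= dotv0l addr0 cos0 mulr1.
Qed.

Lemma is_trigD g h : is_trig g -> is_trig h -> is_trig (fun u => g u + h u).
Proof.
move=> [l gl] [m hm]; exists (l ++ m) => u.
by rewrite gl hm /trig_eval big_cat.
Qed.

Lemma is_trig_cosM (c ph : R) (th : 'cV[R]_p) g : is_trig g ->
  is_trig (fun u => c * cos (ph + dotv th u) * g u).
Proof.
move=> [l gl].
pose sum a := TrigTerm (amplitude a * c / 2) (frequency a + th) (phase a + ph).
pose diff a := TrigTerm (amplitude a * c / 2) (frequency a - th) (phase a - ph).
exists (map sum l ++ map diff l) => u.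
rewrite gl /trig_eval big_cat/= !big_map/= mulr_sumr -big_split/=.
apply: eq_bigr => a _; rewrite dotvDl dotvBl.
rewrite addrACA [phase a - ph + _]addrACA -opprD.
move: (phase a + _) (ph + _) => s t.
by rewrite cosD cosB; field.
Qed.

Lemma is_trigM g h : is_trig g -> is_trig h -> is_trig (fun u => g u * h u).
Proof.
move=> [l gl] trig_h; elim: l g gl => [|a l IHl] g gl.
  apply: eq_is_trig (is_trig_cst 0) => u.
  by rewrite gl /trig_eval big_nil mul0r.
apply: (@eq_is_trig (fun u =>
    amplitude a * cos (phase a + dotv (frequency a) u) * h u
    + trig_eval l u * h u)).
  by move=> u; rewrite gl /trig_eval big_cons mulrDl.
by apply: is_trigD; [exact: is_trig_cosM|exact: IHl].
Qed.

Lemma is_trig_sin (j : 'I_p) (c : R) : is_trig (fun u => sin (c * u j ord0)).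
Proof.
exists [:: TrigTerm 1 (c *: delta_mx j ord0) (- (pi / 2))] => u.
by rewrite /trig_eval big_seq1/= mul1r addrC cosBpihalf dotvZl dotv_delta_mx.
Qed.

Lemma is_trig_bern_mean (q : 'cV[R]_p -> nat -> R) n G y :
  (forall i, is_trig (q ^~ i)) -> is_trig (fun u => bern_mean (q u) n G y).
Proof.
move=> trig_q; elim: n y => [|n IHn] y /=; first exact: is_trig_cst.
apply: is_trigD; apply: is_trigM => //; apply: is_trigD; first exact: is_trig_cst.
apply: eq_is_trig (is_trigM (is_trig_cst (- 1)) (trig_q n)) => u.
by rewrite mulN1r.
Qed.

End trigonometric_polynomials.

(** * Bernstein approximation *)

Lemma continuous_compact_modulus (R : realType) (T U : pseudoMetricType R)
    (h : T -> U) (A : set T) (e : R) :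
  continuous h -> compact A -> 0 < e ->
  exists2 r : R, 0 < r & forall b a, A b -> ball b r a -> ball (h b) e (h a).
Proof.
move=> h_cont A_compact e_gt0.
pose uniform_at r b := forall a, ball b r a -> ball (h b) e (h a).
have near_uniform : \forall r \near 0^'+, A `<=` uniform_at r.
  apply: (proj1 (compact_near_coveringP A) A_compact) => b Ab.
  have e2_gt0 : 0 < e / 2 by rewrite divr_gt0.
  have /cvg_ballP/(_ _ e2_gt0) := h_cont b.
  rewrite -nbhs_ballE => -[r /= r_gt0 ball_h].
  exists (ball b (r / 2), [set s | 0 < s < r / 2]) => /=.
    split; first by apply: nbhsx_ballx; rewrite divr_gt0.
    near=> s; apply/andP; split; near: s; first exact: nbhs_right_gt.
    by apply: nbhs_right_lt; rewrite divr_gt0.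
  move=> [c s] /= [bc /andP[_ s_lt]] a ca.
  have ba : ball b r a.
    by rewrite [r]splitr; apply: ball_triangle bc (le_ball (ltW s_lt) ca).
  have bc' : ball b r c by apply: le_ball bc; lra.
  exact: ball_splitr (ball_h _ bc') (ball_h _ ba).
near (0 : R)^'+ => r; exists r; first by near: r; exact: nbhs_right_gt.
have uniform_r : A `<=` uniform_at r by near: r.
by move=> b a /uniform_r; apply.
Unshelve. all: by end_near. Qed.

Lemma continuous_compact_quadratic_modulus (R : realType) (p : nat)
    (h : 'rV[R]_p -> R) (A : set 'rV[R]_p) (M e : R) :
  continuous h -> compact A -> (forall a, `|h a| <= M) -> 0 < e ->
  exists2 C : R, 0 <= C & forall b a, A b ->
    `|h a - h b| <= e + C * \sum_(j < p) (a ord0 j - b ord0 j) ^+ 2.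
Proof.
move=> h_cont A_compact h_le e_gt0.
have [r r_gt0 modulus] := continuous_compact_modulus h_cont A_compact e_gt0.
have M0 : 0 <= M by apply: le_trans (h_le 0).
exists (2 * M / r ^+ 2) => [|b a Ab]; first by rewrite divr_ge0 ?sqr_ge0// mulr_ge0.
have sqr_dist_ge0 (P : pred 'I_p) :
    0 <= \sum_(j < p | P j) (a ord0 j - b ord0 j) ^+ 2.
  by apply: sumr_ge0 => j _; exact: sqr_ge0.
have [ab|/existsNP[j /negP]] := pselect (forall j, `|a ord0 j - b ord0 j| < r).
  rewrite -[leLHS]addr0; apply: lerD.
    rewrite distrC ltW//; apply: (modulus b a Ab); split=> // i j.
    by rewrite ord1 /ball/= distrC.
  by rewrite mulr_ge0// divr_ge0 ?sqr_ge0// mulr_ge0.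
rewrite -leNgt => far; apply: (@le_trans _ _ (2 * M)).
  by apply: le_trans (ler_normB _ _) _; have := h_le a; have := h_le b; lra.
rewrite -[leLHS]add0r lerD ?(ltW e_gt0)// mulrAC ler_pdivlMr ?exprn_gt0//.
rewrite ler_wpM2l ?mulr_ge0// (bigD1 j)//= -[leLHS]addr0 lerD//.
by rewrite -[leRHS]real_normK ?num_real// lerXn2r ?nnegrE ?(ltW r_gt0).
Qed.

Section bernstein.
Variables (R : realType) (p N : nat).
Hypothesis N_gt0 : (0 < N)%N.
Implicit Types (y : 'rV[R]_p) (z : nat -> R) (j : 'I_p).

(* The [p * N] variables are cut into [p] blocks of length [N], and the variables
   of block [j] have mean [y ord0 j]. *)
Definition block_prob y i : R :=
  if insub ((i %/ N)%N) is Some j then y ord0 j else 0.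

Definition block_weight j i : R := ((i %/ N)%N == j)%:R / N%:R.

Definition block_mean z : 'rV[R]_p :=
  \row_j \sum_(i < p * N) z i * block_weight j i.

Lemma block_prob01 y i : (forall j, 0 <= y ord0 j <= 1) -> 0 <= block_prob y i <= 1.
Proof.
by move=> y01; rewrite /block_prob; case: insubP => [j _ _|_]; rewrite ?lexx ?ler01.
Qed.

Lemma sum_block_weight j : \sum_(i < p * N) block_weight j i = 1.
Proof.
have in_block i : ((i %/ N)%N == j) = (j * N <= i)%N && (i < j.+1 * N)%N.
  by rewrite eqn_leq -leq_divRL// -ltnS ltn_divLR// andbC.
transitivity (\sum_(j * N <= i < j.+1 * N) (N%:R^-1 : R)).
  rewrite (big_nat_widen _ _ (p * N)) ?leq_mul2r ?ltn_ord ?orbT//.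
  rewrite (big_nat_widenl _ 0)// big_mkord [RHS]big_mkcond/=.
  apply: eq_bigr => i _; rewrite /block_weight in_block andbC.
  by case: ifP => _; rewrite ?mul1r ?mul0r.
by rewrite sumr_const_nat mulSn addnK -[LHS]mulr_natr mulVf// pnatr_eq0 -lt0n.
Qed.

Lemma block_mean_prob y : block_mean (block_prob y) = y.
Proof.
apply/rowP => j; rewrite mxE.
transitivity (\sum_(i < p * N) y ord0 j * block_weight j i).
  apply: eq_bigr => i _; rewrite /block_weight /block_prob.
  by have [->|_] := eqVneq (i %/ N)%N (j : nat); rewrite ?valK ?mul0r ?mulr0.
by rewrite -mulr_sumr sum_block_weight mulr1.
Qed.

Lemma block_mean_centered_sum y z j : block_mean z ord0 j - y ord0 j =
  centered_sum (block_prob y) (block_weight j) (p * N) z.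
Proof.
rewrite -[in LHS](block_mean_prob y) !mxE -sumrB.
by apply: eq_bigr => i _; rewrite mulrBl.
Qed.

Lemma bern_mean_block_sqr y z j : (forall j, 0 <= y ord0 j <= 1) ->
  bern_mean (block_prob y) (p * N)
    (fun z => (block_mean z ord0 j - y ord0 j) ^+ 2) z
  <= N%:R^-1.
Proof.
move=> y01; under eq_bern_mean do
  rewrite block_mean_centered_sum -[centered_sum _ _ _ _]add0r.
rewrite (bern_mean_centered_sum_sqr _ _ (c := fun=> 0))// expr0n/= add0r.
have -> : N%:R^-1 = \sum_(i < p * N) N%:R^-1 * block_weight j i :> R.
  by rewrite -mulr_sumr sum_block_weight mulr1.
apply: ler_sum => i _.
rewrite /block_weight; case: eqP => _; last by rewrite mul0r expr0n/= !mulr0.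
have /andP[q0 q1] := block_prob01 i y01.
rewrite mul1r expr2 ler_piMl ?mulr_ge0 ?invr_ge0// /bernoulli_variance; nra.
Qed.

Lemma bern_mean_block_approx (h : 'rV[R]_p -> R) (C e : R) y z : 0 <= C ->
    (forall j, 0 <= y ord0 j <= 1) ->
    (forall a, `|h a - h y| <= e + C * \sum_(j < p) (a ord0 j - y ord0 j) ^+ 2) ->
  `|bern_mean (block_prob y) (p * N) (h \o block_mean) z - h y|
  <= e + C * p%:R / N%:R.
Proof.
move=> C0 y01 h_modulus; rewrite -bern_meanB_cst.
apply: le_trans (ler_norm_bern_mean _ _ _ (fun z => h_modulus (block_mean z))) _.
  by move=> i; exact: block_prob01.
rewrite bern_meanD bern_mean_cst bern_meanZ bern_mean_sum lerD2l -mulrA ler_wpM2l//.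
apply: le_trans (ler_sum _ (fun j _ => bern_mean_block_sqr z j y01)) _.
by rewrite sumr_const card_ord -[leLHS]mulr_natl.
Qed.

End bernstein.

Lemma bernstein_approx (R : realType) (p : nat) (h : 'rV[R]_p -> R) (M e : R) :
  continuous h -> (forall y, `|h y| <= M) -> 0 < e ->
  exists N, forall (y : 'rV[R]_p) z, (forall j, 0 <= y ord0 j <= 1) ->
    `|bern_mean (block_prob N y) (p * N) (h \o block_mean p N) z - h y| <= e.
Proof.
move=> h_cont h_le e_gt0; have e2_gt0 : 0 < e / 2 by rewrite divr_gt0.
pose cube : set 'rV[R]_p := [set y | forall j, `[0, 1]%classic (y ord0 j)].
have cube_compact : compact cube := rV_compact (fun=> @segment_compact _ _ _).
have [C C0 modulus] :=
  continuous_compact_quadratic_modulus h_cont cube_compact h_le e2_gt0.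
pose N := (Num.truncn (2 * C * p%:R / e)).+1; exists N => y z y01.
apply: le_trans (@bern_mean_block_approx _ _ N isT h C (e / 2) y z C0 y01 _) _.
  by move=> a; apply: modulus => j /=; rewrite in_itv/=.
have : 2 * C * p%:R / e < N%:R by exact: truncnS_gt.
rewrite ltr_pdivrMr// => N_large.
have : C * p%:R / N%:R <= e / 2 by rewrite ler_pdivrMr ?ltr0n//; lra.
by lra.
Qed.

Section trigonometric_approximation.
Variables (R : realType) (p : nat).
Implicit Types (u : 'cV[R]_p) (y : 'rV[R]_p) (L : R).

Definition clamp_half (t : R) : R := Num.max (- 2^-1) (Num.min t 2^-1).

Lemma clamp_half_id t : `|t| <= 2^-1 -> clamp_half t = t.
Proof. by rewrite ler_norml => /andP[lb ub]; rewrite /clamp_half min_l// max_r. Qed.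

Lemma ler_norm_clamp_half t : `|clamp_half t| <= 2^-1.
Proof.
by rewrite ler_norml le_max lexx/= ge_max ge_min lexx orbT andbT; lra.
Qed.

Lemma continuous_clamp_half : continuous clamp_half.
Proof.
move=> t; apply: (@continuous_max R R (fun=> - 2^-1) (fun t => Num.min t 2^-1)).
  exact: cvg_cst.
by apply: (@continuous_min R R id (fun=> 2^-1)); [exact: cvg_id|exact: cvg_cst].
Qed.

(* The coordinates [sin (u_j / 2L)] stay within [-1/2, 1/2] on the cube
   [|u_j| <= L], where [asin] recovers [u_j]; they are rescaled to [0, 1]. *)
Definition sine_chart L u : 'rV[R]_p :=
  \row_j ((1 + sin ((2 * L)^-1 * u j ord0)) / 2).

Definition sine_chart_inv L y : 'cV[R]_p :=
  \col_j (2 * L * asin (clamp_half (2 * y ord0 j - 1))).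

Lemma sine_chart01 L u j : 0 <= sine_chart L u ord0 j <= 1.
Proof.
rewrite mxE; have := sin_geN1 ((2 * L)^-1 * u j ord0).
by have := sin_le1 ((2 * L)^-1 * u j ord0); lra.
Qed.

Lemma sine_chartK L u : 0 < L -> (forall j, `|u j ord0| <= L) ->
  sine_chart_inv L (sine_chart L u) = u.
Proof.
move=> L_gt0 uL; have L2_gt0 : 0 < 2 * L by rewrite mulr_gt0.
apply/matrixP => j k; rewrite (ord1 k) !mxE; set t := (2 * L)^-1 * u j ord0.
have t_le : `|t| <= 2^-1.
  rewrite normrM gtr0_norm ?invr_gt0// mulrC ler_pdivrMr//.
  by have := uL j; lra.
rewrite (_ : 2 * _ - 1 = sin t); last by field.
rewrite clamp_half_id; last exact: le_trans (ler_norm_sin t) t_le.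
rewrite sinK; first by rewrite mulVKf ?gt_eqF.
by rewrite in_itv/=; have := pihalf_ge1 R; move: t_le; rewrite ler_norml; lra.
Qed.

Lemma continuous_sine_chart_inv L : continuous (sine_chart_inv L).
Proof.
pose coord (t : R) := 2 * L * asin (clamp_half (2 * t - 1)).
have coord_cont : continuous coord.
  move=> t; apply: cvgM; first exact: cvg_cst.
  apply: (@continuous_comp _ _ _ (fun t : R => clamp_half (2 * t - 1)) asin).
    apply: (@continuous_comp _ _ _ (fun t : R => 2 * t - 1) clamp_half).
      by apply: cvgB; [exact: mulrl_continuous|exact: cvg_cst].
    exact: continuous_clamp_half.
  apply: continuous_asin; have := ler_norm_clamp_half (2 * t - 1).
  by rewrite ler_norml; lra.
move=> y; apply/(@cvg_ballP _ _ _ _ (nbhs_filter y)) => e e_gt0.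
have near_coord j : \forall z \near y,
    ball (coord (y ord0 j)) e (coord ((z : 'rV_p) ord0 j)).
  have : (coord \o (fun y : 'rV[R]_p => y ord0 j)) @ y --> coord (y ord0 j).
    apply: (@continuous_comp _ _ _ (fun y : 'rV[R]_p => y ord0 j) coord).
      exact: coord_continuous.
    exact: coord_cont.
  by move/cvg_ballP; apply.
have := filter_forall (nbhs_filter y) near_coord.
by apply: filterS => z yz; split=> // j k; rewrite !mxE; exact: yz.
Qed.

Lemma is_trig_block_prob L N i : is_trig (fun u => block_prob N (sine_chart L u) i).
Proof.
rewrite /block_prob; case: insubP => [j _ _|_]; last exact: is_trig_cst.
apply: eq_is_trig (is_trigM (is_trigD (is_trig_cst _ 1) (is_trig_sin j (2 * L)^-1))
  (is_trig_cst _ 2^-1)) => u.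
by rewrite mxE.
Qed.

Lemma is_trig_approx (f : 'cV[R]_p -> R) (M L e : R) :
  continuous f -> (forall u, `|f u| <= M) -> 0 < L -> 0 < e ->
  exists g, [/\ is_trig g, forall u, `|g u| <= M &
    forall u, (forall j, `|u j ord0| <= L) -> `|f u - g u| <= e].
Proof.
move=> f_cont f_le L_gt0 e_gt0; pose h := f \o sine_chart_inv L.
have h_cont : continuous h.
  move=> y; apply: continuous_comp; last exact: f_cont.
  exact: continuous_sine_chart_inv.
have h_le y : `|h y| <= M by exact: f_le.
have [N approx] := bernstein_approx h_cont h_le e_gt0.
pose g u := bern_mean (block_prob N (sine_chart L u)) (p * N)
  (h \o block_mean p N) (fun=> 0).
exists g; split=> [|u|u uL].
- by apply: is_trig_bern_mean => i; exact: is_trig_block_prob.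
- rewrite -[leRHS](bern_mean_cst (block_prob N (sine_chart L u)) (p * N) M
    (fun=> 0)).
  apply: ler_norm_bern_mean => [i|z]; last exact: h_le.
  by apply: block_prob01 => j; exact: sine_chart01.
rewrite -{1}[u](sine_chartK L_gt0 uL) distrC; apply: approx => j.
exact: sine_chart01.
Qed.

End trigonometric_approximation.

(** * Integrals against the standard normal law *)

Section integral_sandwich.
Context d (T : measurableType d) (R : realType) (mu : {measure set T -> \bar R}).

(* The integral of a nonnegative function is a supremum over the simple
   functions below it, so monotonicity does not need measurability. *)
Lemma ge0_le_integral_nonmeasurable (f g : T -> \bar R) :
  (forall x, 0 <= f x)%E -> (forall x, f x <= g x)%E ->
  (\int[mu]_x f x <= \int[mu]_x g x)%E.
Proof.
move=> f0 fg; have g0 x : (0 <= g x)%E by exact: le_trans (f0 x) (fg x).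
rewrite !ge0_integralTE//; apply: le_ereal_sup => _ [h h_le <-].
by exists h => // x; apply: le_trans (h_le x) _.
Qed.

Lemma le_integral_nonmeasurable (f g : T -> \bar R) :
  (forall x, f x <= g x)%E -> (\int[mu]_x f x <= \int[mu]_x g x)%E.
Proof.
move=> fg; rewrite integralE [leRHS]integralE; apply: leeB.
  apply: ge0_le_integral_nonmeasurable => // x.
  by apply: (@funepos_le _ _ setT); rewrite ?inE.
apply: ge0_le_integral_nonmeasurable => // x.
by apply: (@funeneg_le _ _ setT); rewrite ?inE.
Qed.

Lemma Rintegral_sandwich (f g h : T -> R) :
  mu.-integrable setT (EFin \o g) -> mu.-integrable setT (EFin \o h) ->
  (forall x, `|f x - g x| <= h x) ->
  `|\int[mu]_x f x - \int[mu]_x g x| <= \int[mu]_x h x.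
Proof.
move=> g_int h_int fgh.
have g_fin := integrable_fin_num measurableT g_int.
have h_fin := integrable_fin_num measurableT h_int.
have ub : (\int[mu]_x (f x)%:E <= \int[mu]_x (g x)%:E + \int[mu]_x (h x)%:E)%E.
  rewrite -(integralD_EFin measurableT g_int h_int).
  apply: le_integral_nonmeasurable => x /=.
  by rewrite -EFinD lee_fin; have := fgh x; rewrite ler_norml; lra.
have lb : (\int[mu]_x (g x)%:E - \int[mu]_x (h x)%:E <= \int[mu]_x (f x)%:E)%E.
  rewrite -(integralB_EFin measurableT g_int h_int).
  apply: le_integral_nonmeasurable => x /=.
  by rewrite -EFinB lee_fin; have := fgh x; rewrite ler_norml; lra.
rewrite /= in g_fin h_fin; rewrite /Rintegral.
move: ub lb; rewrite -(fineK g_fin) -(fineK h_fin) -EFinD -EFinB /=.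
case: (\int[mu]_x (f x)%:E)%E => [r| |]//=; rewrite !lee_fin => ub lb.
by rewrite ler_norml; lra.
Qed.

End integral_sandwich.

Lemma Rintegral_probability_cst d (T : measurableType d) (R : realType)
    (P : probability T R) (c : R) : \int[P]_x c = c.
Proof.
by rewrite Rintegral_cst//= -[fine _]/(fine (P setT)) probability_setT mulr1.
Qed.

Lemma Rintegral_FTC2_line (R : realType) (F f : R -> R) (l m : R) :
    (forall x : R, is_derive x 1 F (f x)) -> continuous f ->
    lebesgue_measure.-integrable setT (EFin \o f) ->
    F x @[x --> -oo] --> l -> F x @[x --> +oo] --> m ->
  \int[lebesgue_measure]_x f x = m - l.
Proof.
move=> F_deriv f_cont f_int F_l F_m.
have F_cont := is_derive_continuous F_deriv.
pose I n : set R := `[- n.+1%:R, n.+1%:R]%classic.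
have truncated_cvg :
    (\int[lebesgue_measure]_x ((EFin \o f) \_ (I n)) x)%E @[n --> \oo] -->
    (\int[lebesgue_measure]_x (f x)%:E)%E.
  apply: (@dominated_cvg _ _ _ (@lebesgue_measure R) setT _
    (fun n => (EFin \o f) \_ (I n)) (EFin \o f) (fun x => `|(f x)%:E|%E)) => //.
  - move=> n; apply/(measurable_restrictT _ _).1; first exact: measurable_itv.
    exact: measurable_funTS (measurable_int _ f_int).
  - move=> x _; apply: cvg_near_cst; near=> n; rewrite patchE ifT// inE /I/=.
    rewrite in_itv/= -ler_norml ltW// (lt_le_trans (truncnS_gt _))// ler_nat ltnS.
    by near: n; exact: nbhs_infty_ge.
  - exact: integrable_abse.
  - by move=> n x _; rewrite patchE; case: ifP => // _; rewrite abse0 abse_ge0.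
have truncatedE n : (\int[lebesgue_measure]_x ((EFin \o f) \_ (I n)) x)%E =
    (F n.+1%:R - F (- n.+1%:R))%:E.
  rewrite -integral_mkcond (@continuous_FTC2 _ f F)//.
  - by rewrite (@lt_trans _ _ 0)// ?oppr_lt0 ltr0n.
  - exact: continuous_subspaceT.
  - split; first by move=> x _; have [] := F_deriv x.
      exact/cvg_at_right_filter/F_cont.
    exact/cvg_at_left_filter/F_cont.
  - by move=> x _; rewrite derive1E; have [_ ->] := F_deriv x.
have increment_cvg : (fun n => F n.+1%:R - F (- n.+1%:R)) @ \oo --> m - l.
  have succ_cvgy : (n.+1%:R : R) @[n --> \oo] --> +oo.
    by rewrite (cvg_shiftS (fun n => n%:R : R)); exact: cvgr_idn.
  apply: cvgB; first exact: cvg_comp succ_cvgy F_m.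
  by move/cvgNy_compNP : F_l; exact: cvg_comp.
suff integralE : (\int[lebesgue_measure]_x (f x)%:E)%E = (m - l)%:E.
  by rewrite /Rintegral integralE.
apply: cvg_unique truncated_cvg _ => //; rewrite (funext truncatedE).
by apply: cvg_EFin => //; exact: nearW.
Unshelve. all: by end_near. Qed.

Section std_normal_integrals.
Variable R : realType.
Implicit Types (f g : R -> R) (c t x : R).
Local Notation mu := (@lebesgue_measure R).
Local Notation std_normal := (@normal_prob R 0 1).
Local Notation pdf := (@normal_pdf R 0 1).

Lemma std_normal_pdfE x : pdf x = normal_peak 1 * expR (- x ^+ 2 / 2).
Proof. by rewrite normal_pdfE ?oner_neq0// /normal_fun subr0 expr1n mulr2n. Qed.

Lemma is_derive_std_normal_pdf x : is_derive x 1 pdf (- x * pdf x).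
Proof.
rewrite (_ : pdf = fun x => normal_peak 1 * expR (- x ^+ 2 / 2)); last first.
  by apply/funext => y; exact: std_normal_pdfE.
by apply: is_derive_eq; rewrite /GRing.scale/=; field.
Qed.

Lemma std_normal_pdf_cvgy : pdf x @[x --> +oo] --> 0.
Proof.
have ub_cvg : normal_peak 1 * expR 1 * expR (- x) @[x --> +oo] --> (0 : R).
  rewrite -[X in _ --> X](mulr0 (normal_peak 1 * expR 1)).
  by apply: cvgM; [exact: cvg_cst|exact: cvgr_expR].
apply: squeeze_cvgr (cvg_cst 0) ub_cvg; apply: nearW => x.
rewrite normal_pdf_ge0 std_normal_pdfE -mulrA -expRD ler_wpM2l ?normal_peak_ge0//.
by rewrite ler_expR; have := sqr_ge0 (x - 1); nra.
Qed.

Lemma std_normal_pdf_cvgNy : pdf x @[x --> -oo] --> 0.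
Proof.
apply/cvgNy_compNP; rewrite (_ : _ \o _ = pdf); first exact: std_normal_pdf_cvgy.
by apply/funext => x /=; rewrite !std_normal_pdfE sqrrN.
Qed.

Lemma ge0_integral_std_normal (f : R -> \bar R) : (forall x, 0 <= f x)%E ->
  measurable_fun setT f ->
  (\int[std_normal]_x f x = \int[mu]_x (f x * (pdf x)%:E))%E.
Proof.
move=> f0 mf; have pdf_meas : measurable_fun setT (fun x => (pdf x)%:E).
  by apply/measurable_EFinP; exact: measurable_normal_pdf.
have dom := @normal_prob_dominates R 0 1.
rewrite -(Radon_Nikodym_SigmaFinite.change_of_variables dom f0 measurableT mf).
have RN_int := Radon_Nikodym_SigmaFinite.f_integrable dom.
apply: ae_eq_integral => //.
- by apply: emeasurable_funM => //; exact: measurable_int RN_int.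
- exact: emeasurable_funM.
apply: ae_eqe_mul2l; apply: integral_ae_eq => // E _ mE.
by rewrite -Radon_Nikodym_SigmaFinite.f_integral.
Qed.

Definition quadratic_growth g := exists A, forall x, `|g x| <= A * (1 + x ^+ 2).

Lemma quadratic_growth_bounded g (A : R) :
  (forall x, `|g x| <= A) -> quadratic_growth g.
Proof.
move=> gA; exists A => x; rewrite (le_trans (gA x))// ler_peMr ?lerDl ?sqr_ge0//.
exact: le_trans (gA x).
Qed.

Lemma quadratic_growth_sqr : quadratic_growth (fun x => x ^+ 2).
Proof. by exists 1 => x; rewrite mul1r ger0_norm ?sqr_ge0// lerDr. Qed.

Lemma quadratic_growthD f g : quadratic_growth f -> quadratic_growth g ->
  quadratic_growth (fun x => f x + g x).
Proof.
move=> [A fA] [B gB]; exists (A + B) => x.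
by rewrite (le_trans (ler_normD _ _))// mulrDl lerD.
Qed.

Lemma ler_norm_1Dsqr x : `|x| <= 1 + x ^+ 2.
Proof.
by rewrite ler_norml; have := sqr_ge0 (x - 1); have := sqr_ge0 (x + 1); nra.
Qed.

Lemma quadratic_growth_idM g (A : R) :
  (forall x, `|g x| <= A) -> quadratic_growth (fun x => x * g x).
Proof.
move=> gA; exists A => x; rewrite normrM mulrC.
by apply: ler_pM => //; exact: ler_norm_1Dsqr.
Qed.

(* The factor [1 + x ^+ 2] is absorbed by the wider normal density. *)
Lemma std_normal_pdf_quadratic_le : exists2 K : R, 0 <= K &
  forall x, (1 + x ^+ 2) * pdf x <= K * normal_pdf 0 2 x.
Proof.
have peak2 : 0 < @normal_peak R 2 by rewrite normal_peak_gt0// pnatr_eq0.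
exists (3 * normal_peak 1 / normal_peak 2).
  by rewrite divr_ge0 ?mulr_ge0 ?normal_peak_ge0.
move=> x; rewrite std_normal_pdfE normal_pdfE ?pnatr_eq0// /normal_fun subr0.
rewrite (_ : - x ^+ 2 / 2 =
  - (x ^+ 2 * (3 / 8)) + - x ^+ 2 / (2 ^+ 2 *+ 2)); last by rewrite mulr2n; field.
rewrite expRD; set narrow := expR _; set wide := expR _.
rewrite [leRHS](_ : _ = normal_peak 1 * wide * 3);
  last by field; rewrite gt_eqF.
rewrite [leLHS](_ : _ = normal_peak 1 * wide * ((1 + x ^+ 2) * narrow));
  last by ring.
rewrite ler_wpM2l ?mulr_ge0 ?normal_peak_ge0 ?expR_ge0//.
rewrite /narrow expRN ler_pdivrMr ?expR_gt0//.
by have := expR_ge1Dx (x ^+ 2 * (3 / 8)); have := sqr_ge0 x; lra.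
Qed.

Lemma integrable_mul_std_normal_pdf g : measurable_fun setT g ->
  quadratic_growth g -> mu.-integrable setT (EFin \o (fun x => g x * pdf x)).
Proof.
move=> mg [A gA]; have [K K0 pdf_le] := std_normal_pdf_quadratic_le.
have dom_int : mu.-integrable setT
    (fun x => ((`|A| * K)%:E * (normal_pdf 0 2 x)%:E)%E).
  by apply: integrableZl => //; exact: integrable_normal_pdf.
apply: le_integrable dom_int => //.
  by apply/measurable_EFinP/measurable_funM => //; exact: measurable_normal_pdf.
move=> x _ /=; rewrite lee_fin !normrM normr_id.
rewrite !(ger0_norm (normal_pdf_ge0 _ _ _)) (ger0_norm K0) -mulrA.
apply: le_trans (ler_wpM2l (normr_ge0 A) (pdf_le x)).
rewrite mulrA ler_wpM2r ?normal_pdf_ge0// (le_trans (gA x))//.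
by rewrite ler_wpM2r ?ler_norm// addr_ge0// sqr_ge0.
Qed.

Lemma integrable_std_normal g : measurable_fun setT g -> quadratic_growth g ->
  std_normal.-integrable setT (EFin \o g).
Proof.
move=> mg g_growth; apply/integrableP; split; first exact/measurable_EFinP.
rewrite ge0_integral_std_normal//; last first.
  by apply: measurableT_comp => //; exact/measurable_EFinP.
have /integrableP[_] := integrable_mul_std_normal_pdf mg g_growth.
congr (_ < _)%E; apply: eq_integral => x _ /=.
by rewrite normrM (ger0_norm (normal_pdf_ge0 0 1 x)) EFinM.
Qed.

Lemma Rintegral_std_normal g : measurable_fun setT g ->
  \int[std_normal]_x g x = \int[mu]_x (g x * pdf x).
Proof.
move=> mg; rewrite /Rintegral integralE [in RHS]integralE.
have mg' : measurable_fun setT (fun x => (g x)%:E) by exact/measurable_EFinP.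
rewrite (ge0_integral_std_normal (funepos_ge0 _) (measurable_funepos mg')).
rewrite (ge0_integral_std_normal (funeneg_ge0 _) (measurable_funeneg mg')).
have pdf0 x : 0 <= pdf x := normal_pdf_ge0 0 1 x.
congr (fine (_ - _)%E); apply: eq_integral => x _.
- by rewrite !funeposE -!EFin_max -EFinM maxr_pMl// mul0r.
- by rewrite !funenegE -!EFinN -!EFin_max -EFinM maxr_pMl// mul0r mulNr.
Qed.

(* Integration by parts: [(F pdf)' = (F' - x F) pdf]. *)
Lemma std_normal_stein (F f : R -> R) (A : R) :
    (forall x : R, is_derive x 1 F (f x)) -> continuous f ->
    (forall x, `|F x| <= A) -> quadratic_growth f ->
  \int[std_normal]_x (f x - x * F x) = 0.
Proof.
move=> F_deriv f_cont F_le f_growth.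
have F_cont := is_derive_continuous F_deriv.
have xF_cont : continuous (fun x => f x - x * F x).
  move=> x; apply: cvgB; first exact: f_cont.
  by apply: cvgM; [exact: cvg_id|exact: F_cont].
have xF_meas := continuous_measurable_fun xF_cont.
rewrite (Rintegral_std_normal xF_meas).
have Fpdf_deriv (x : R) :
    is_derive x 1 (fun x => F x * pdf x) ((f x - x * F x) * pdf x).
  have := F_deriv x; have := is_derive_std_normal_pdf x => pdf_deriv F_deriv_x.
  by apply: is_derive_eq; rewrite /GRing.scale/=; ring.
have xFpdf_cont : continuous (fun x => (f x - x * F x) * pdf x).
  by move=> x; apply: cvgM; [exact: xF_cont|exact/continuous_normal_pdf/oner_neq0].
have xFpdf_int : mu.-integrable setT (EFin \o (fun x => (f x - x * F x) * pdf x)).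
  apply: integrable_mul_std_normal_pdf xF_meas _.
  under eq_fun do rewrite -mulrN; apply: quadratic_growthD => //.
  by apply: (@quadratic_growth_idM _ A) => x; rewrite normrN.
have Fpdf_cvg0 (G : set_system R) : Filter G ->
    pdf x @[x --> G] --> 0 -> F x * pdf x @[x --> G] --> 0.
  move=> filterG pdf_cvg0; apply: norm_cvg0.
  have ub_cvg : A * pdf x @[x --> G] --> (0 : R).
    by rewrite -[X in _ --> X](mulr0 A); apply: cvgM => //; exact: cvg_cst.
  apply: squeeze_cvgr (cvg_cst 0) ub_cvg; apply: nearW => x.
  rewrite normr_ge0 normrM (ger0_norm (normal_pdf_ge0 0 1 x)).
  by rewrite ler_wpM2r ?normal_pdf_ge0.
rewrite (Rintegral_FTC2_line Fpdf_deriv xFpdf_cont xFpdf_int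
  (Fpdf_cvg0 _ _ std_normal_pdf_cvgNy) (Fpdf_cvg0 _ _ std_normal_pdf_cvgy)).
by rewrite subrr.
Qed.

End std_normal_integrals.

Section std_normal_characteristic_function.
Variable R : realType.
Implicit Types c t x : R.
Local Notation std_normal := (@normal_prob R 0 1).

Lemma is_derive_cos_affine c t x :
  is_derive x 1 (fun x => cos (c + t * x)) (- (t * sin (c + t * x))).
Proof. by apply: is_derive_eq; rewrite /GRing.scale/=; ring. Qed.

Lemma is_derive_sin_affine c t x :
  is_derive x 1 (fun x => sin (c + t * x)) (t * cos (c + t * x)).
Proof. by apply: is_derive_eq; rewrite /GRing.scale/=; ring. Qed.

Lemma continuous_cos_affine c t : continuous (fun x : R => cos (c + t * x)).
Proof. exact: is_derive_continuous (is_derive_cos_affine c t). Qed.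

Lemma continuous_sin_affine c t : continuous (fun x : R => sin (c + t * x)).
Proof. exact: is_derive_continuous (is_derive_sin_affine c t). Qed.

Lemma integrable_std_normal_cos c t :
  std_normal.-integrable setT (EFin \o (fun x => cos (c + t * x))).
Proof.
apply: integrable_std_normal.
  by apply: continuous_measurable_fun; exact: continuous_cos_affine.
exact: quadratic_growth_bounded (fun x => normr_cos_le1 _).
Qed.

Lemma integrable_std_normal_idM_sin c t :
  std_normal.-integrable setT (EFin \o (fun x => x * sin (c + t * x))).
Proof.
apply: integrable_std_normal.
  apply: continuous_measurable_fun => x.
  by apply: cvgM; [exact: cvg_id|exact: continuous_sin_affine].
exact: quadratic_growth_idM (fun x => normr_sin_le1 _).
Qed.

Lemma integrable_std_normal_sqr :
  std_normal.-integrable setT (EFin \o (fun x : R => x ^+ 2)).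
Proof.
apply: integrable_std_normal (quadratic_growth_sqr R).
by apply: continuous_measurable_fun; exact: exprn_continuous.
Qed.

Lemma integrable_std_normal_cst c : std_normal.-integrable setT (EFin \o (fun=> c)).
Proof.
by apply: integrable_std_normal => //; exact: (@quadratic_growth_bounded _ _ `|c|).
Qed.

Lemma Rintegral_std_normal_idM_sin c t :
  \int[std_normal]_x (x * sin (c + t * x)) =
  t * \int[std_normal]_x cos (c + t * x).
Proof.
have cos_int := integrable_std_normal_cos c t.
have tcos_int :
    std_normal.-integrable setT (EFin \o (fun x => t * cos (c + t * x))).
  exact: (integrableZl measurableT t cos_int).
rewrite -RintegralZl//; apply/esym/eqP; rewrite -subr_eq0; apply/eqP.
rewrite -RintegralB//; last exact: integrable_std_normal_idM_sin.
apply: (std_normal_stein (A := 1) (fun x => is_derive_sin_affine c t x)).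
- by move=> x; apply: cvgM; [exact: cvg_cst|exact: continuous_cos_affine].
- by move=> x; exact: normr_sin_le1.
apply: (@quadratic_growth_bounded _ _ `|t|) => x.
by rewrite normrM ler_piMr// normr_cos_le1.
Qed.

Lemma is_derive_Rintegral_std_normal_cos c t :
  is_derive t 1 (fun t => \int[std_normal]_x cos (c + t * x))
    (- t * \int[std_normal]_x cos (c + t * x)).
Proof.
pose f (s x : R) := cos (c + s * x).
have f_deriv (s x : R) : is_derive s 1 (f ^~ x) (- (x * sin (c + s * x))).
  by rewrite /f; apply: is_derive_eq; rewrite /GRing.scale/=; ring.
have f_partial s x : partial1of2 f s x = - (x * sin (c + s * x)).
  by rewrite partial1of2E; have [_ ->] := f_deriv s x.
have t_in : `]t - 1, t + 1[%classic t by rewrite /= in_itv/=; lra.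
have f_int s : `]t - 1, t + 1[%classic s ->
    std_normal.-integrable setT (EFin \o f s).
  by move=> _; exact: integrable_std_normal_cos.
have f_derivable (s x : R) :
    `]t - 1, t + 1[%classic s -> setT x -> derivable (f ^~ x) s 1.
  by move=> _ _; have [] := f_deriv s x.
have dom_ge0 (x : R) : 0 <= 1 + x ^+ 2 by rewrite addr_ge0 ?sqr_ge0.
have dom_int : std_normal.-integrable setT (EFin \o (fun x : R => 1 + x ^+ 2)).
  exact: (integrableD measurableT (integrable_std_normal_cst 1)
    integrable_std_normal_sqr).
have f_dom (s x : R) : `]t - 1, t + 1[%classic s -> setT x ->
    `|partial1of2 f s x| <= 1 + x ^+ 2.
  move=> _ _; rewrite f_partial normrN normrM (le_trans _ (ler_norm_1Dsqr x))//.
  by rewrite ler_piMr// normr_sin_le1.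
split; first exact: (derivable_under_integral measurableT t_in f_int
  f_derivable dom_ge0 dom_int f_dom).
have := differentiation_under_integral measurableT t_in f_int
  f_derivable dom_ge0 dom_int f_dom.
rewrite derive1E => ->.
rewrite mulNr -Rintegral_std_normal_idM_sin -mulN1r -RintegralZl//.
  by apply: eq_Rintegral => x _; rewrite f_partial mulN1r.
exact: integrable_std_normal_idM_sin.
Qed.

(* The mean [psi t] satisfies [psi' t = - t psi t]. *)
Lemma Rintegral_std_normal_cos c t :
  \int[std_normal]_x cos (c + t * x) = expR (- t ^+ 2 / 2) * cos c.
Proof.
pose psi t := \int[std_normal]_x cos (c + t * x).
have psi_exp_deriv (s : R) : is_derive s 1 (fun s => psi s * expR (s ^+ 2 / 2)) 0.
  have psi_deriv : is_derive s 1 psi (- s * psi s).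
    exact: is_derive_Rintegral_std_normal_cos.
  by apply: is_derive_eq; rewrite /GRing.scale/=; field.
have := is_derive_0_is_cst t 0 psi_exp_deriv.
rewrite expr0n/= mul0r expR0 mulr1 => psi_exp_cst.
have psi0 : psi 0 = cos c.
  rewrite /psi -[RHS](Rintegral_probability_cst std_normal).
  by apply: eq_Rintegral => x _; rewrite mul0r addr0.
rewrite -/(psi t) -psi0 -psi_exp_cst mulrC -mulrA -expRD.
by rewrite (_ : _ + _ = 0) ?expR0 ?mulr1//; field.
Qed.

End std_normal_characteristic_function.

Section iterated_gaussian_mean.
Variable R : realType.
Implicit Types (g h : (nat -> R) -> R) (z th : nat -> R) (k : nat).
Local Notation std_normal := (@normal_prob R 0 1).

Fixpoint gauss_integrable k g : Prop :=
  match k with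
  | 0 => True
  | k.+1 => gauss_integrable k g /\ forall z,
      std_normal.-integrable setT (EFin \o (fun t => gauss_iter k g (update z k t)))
  end.

Lemma gauss_iterS k g z :
  gauss_iter k.+1 g z = \int[std_normal]_t gauss_iter k g (update z k t).
Proof. by []. Qed.

Lemma gauss_iter_sandwich k f g h :
  gauss_integrable k g -> gauss_integrable k h -> (forall z, `|f z - g z| <= h z) ->
  forall z, `|gauss_iter k f z - gauss_iter k g z| <= gauss_iter k h z.
Proof.
move=> + + fgh; elim: k => [//|k IHk] [g_int gk_int] [h_int hk_int] z.
by rewrite !gauss_iterS; apply: Rintegral_sandwich => // t; exact: IHk.
Qed.

Definition gauss_mean k g m := gauss_integrable k g /\ gauss_iter k g =1 m.

Lemma eq_gauss_mean k g g' m m' : g =1 g' -> m =1 m' -> gauss_mean k g m ->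
  gauss_mean k g' m'.
Proof. by move=> /funext -> /funext ->. Qed.

Lemma gauss_mean_cst k (c : R) : gauss_mean k (fun=> c) (fun=> c).
Proof.
elim: k => [//|k [c_int c_iter]]; split=> [|z].
  by split=> // z; rewrite (funext c_iter); exact: integrable_std_normal_cst.
by rewrite gauss_iterS (funext c_iter) Rintegral_probability_cst.
Qed.

Lemma gauss_meanD k g g' : gauss_integrable k g -> gauss_integrable k g' ->
  gauss_mean k (fun z => g z + g' z)
    (fun z => gauss_iter k g z + gauss_iter k g' z).
Proof.
elim: k => [//|k IHk] [g_int gk_int] [g'_int gk'_int].
have [sum_int sum_iter] := IHk g_int g'_int; split=> [|z].
  split=> // z; rewrite (funext sum_iter).
  exact: (integrableD measurableT (gk_int z) (gk'_int z)).
by rewrite gauss_iterS (funext sum_iter) RintegralD.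
Qed.

Lemma gauss_meanZ k g (c : R) : gauss_integrable k g ->
  gauss_mean k (fun z => c * g z) (fun z => c * gauss_iter k g z).
Proof.
elim: k => [//|k IHk] [g_int gk_int].
have [scaled_int scaled_iter] := IHk g_int; split=> [|z].
  split=> // z; rewrite (funext scaled_iter).
  exact: (integrableZl measurableT c (gk_int z)).
by rewrite gauss_iterS (funext scaled_iter) RintegralZl.
Qed.

Lemma gauss_mean_sum k (I : Type) (r : seq I) (g m : I -> (nat -> R) -> R) :
  (forall i, gauss_mean k (g i) (m i)) ->
  gauss_mean k (fun z => \sum_(i <- r) g i z) (fun z => \sum_(i <- r) m i z).
Proof.
move=> mean_g; elim: r => [|i r [r_int r_iter]].
  by apply: eq_gauss_mean (gauss_mean_cst k 0) => z; rewrite big_nil.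
have [i_int i_iter] := mean_g i.
apply: eq_gauss_mean (gauss_meanD i_int r_int) => z; rewrite big_cons//.
by rewrite i_iter r_iter.
Qed.

Lemma sum_nat_update (F : nat -> R -> R) z k n t : (k < n)%N ->
  \sum_(k <= i < n) F i (update z k t i) = F k t + \sum_(k.+1 <= i < n) F i (z i).
Proof.
move=> kn; rewrite big_ltn// update_same; congr (_ + _).
by apply: eq_big_nat => i /andP[ki _]; rewrite /update gtn_eqF.
Qed.

Lemma gauss_mean_cos k n (c : R) th : (k <= n)%N ->
  gauss_mean k (fun z => cos (c + \sum_(0 <= i < n) th i * z i))
    (fun z => expR (- (\sum_(0 <= i < k) th i ^+ 2) / 2)
              * cos (c + \sum_(k <= i < n) th i * z i)).
Proof.
elim: k => [_|k IHk kn].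
  by split=> // z; rewrite big_geq// oppr0 mul0r expR0 mul1r.
have [k_int k_iter] := IHk (ltnW kn).
have iterE z t :
    gauss_iter k (fun z => cos (c + \sum_(0 <= i < n) th i * z i)) (update z k t) =
    expR (- (\sum_(0 <= i < k) th i ^+ 2) / 2)
      * cos (c + \sum_(k.+1 <= i < n) th i * z i + th k * t).
  by rewrite k_iter (sum_nat_update (fun i t => th i * t))// addrCA addrC.
split=> [|z].
  split=> // z; rewrite (funext (iterE z)).
  exact: (integrableZl measurableT _ (integrable_std_normal_cos _ _)).
rewrite gauss_iterS (funext (iterE z)) RintegralZl//; last first.
  exact: integrable_std_normal_cos.
rewrite Rintegral_std_normal_cos mulrA -expRD big_nat_recr//=.
by congr (expR _ * _); ring.
Qed.

Definition normal_second_moment : R := \int[std_normal]_x (x ^+ 2).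

Lemma normal_second_moment_ge0 : 0 <= normal_second_moment.
Proof. by apply: Rintegral_ge0 => x _; exact: sqr_ge0. Qed.

Lemma gauss_mean_sum_sqr k n : (k <= n)%N ->
  gauss_mean k (fun z => \sum_(0 <= i < n) z i ^+ 2)
    (fun z => k%:R * normal_second_moment + \sum_(k <= i < n) z i ^+ 2).
Proof.
elim: k => [_|k IHk kn]; first by split=> // z; rewrite mul0r add0r.
have [k_int k_iter] := IHk (ltnW kn).
have iterE z t :
    gauss_iter k (fun z => \sum_(0 <= i < n) z i ^+ 2) (update z k t) =
    k%:R * normal_second_moment + \sum_(k.+1 <= i < n) z i ^+ 2 + t ^+ 2.
  by rewrite k_iter (sum_nat_update (fun _ t => t ^+ 2))// addrCA addrC.
have sqr_int := integrable_std_normal_sqr R.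
split=> [|z].
  split=> // z; rewrite (funext (iterE z)).
  exact: (integrableD measurableT (integrable_std_normal_cst _) sqr_int).
rewrite gauss_iterS (funext (iterE z)) RintegralD//; last first.
  exact: integrable_std_normal_cst.
by rewrite Rintegral_probability_cst -/normal_second_moment -natr1; ring.
Qed.

End iterated_gaussian_mean.

Section std_normal_expectation.
Variables (R : realType) (p : nat).
Implicit Types (u : 'cV[R]_p) (l : seq (trig_term R p)).

Definition col_coef u i : R := if insub i is Some j then u j ord0 else 0.

Lemma sum_col_coef (F : R -> nat -> R) u :
  \sum_(0 <= i < p) F (col_coef u i) i = \sum_(j < p) F (u j ord0) j.
Proof. by rewrite big_mkord; apply: eq_bigr => j _; rewrite /col_coef valK. Qed.

Definition trig_normal_mean l : R :=
  \sum_(a <- l) amplitude a *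
    (expR (- dotv (frequency a) (frequency a) / 2) * cos (phase a)).

Lemma gauss_mean_trig_eval l :
  gauss_mean p (fun z => trig_eval l (\col_i z i)) (fun=> trig_normal_mean l).
Proof.
apply: gauss_mean_sum => a; pose th := col_coef (frequency a).
have [cos_int cos_iter] := gauss_mean_cos (phase a) th (leqnn p).
apply: eq_gauss_mean (gauss_meanZ (amplitude a) cos_int) => z.
  rewrite (sum_col_coef (fun t i => t * z i)) dotvE; congr (_ * cos (_ + _)).
  by apply: eq_bigr => j _; rewrite mxE.
rewrite cos_iter (big_geq (leqnn p)) addr0 (sum_col_coef (fun t _ => t ^+ 2)) dotvE.
by under eq_bigr do rewrite expr2.
Qed.

Lemma gauss_mean_eucl_norm_sqr :
  gauss_mean p (fun z => eucl_norm (\col_(i < p) z i) ^+ 2)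
    (fun=> p%:R * normal_second_moment R).
Proof.
apply: eq_gauss_mean (gauss_mean_sum_sqr R (leqnn p)) => z; last first.
  by rewrite (big_geq (leqnn p)) addr0.
by rewrite eucl_norm_sqr dotvE big_mkord; apply: eq_bigr => i _; rewrite mxE expr2.
Qed.

Lemma std_normal_expect_trig (f : 'cV[R]_p -> R) l (e C : R) :
  (forall u, `|f u - trig_eval l u| <= e + C * eucl_norm u ^+ 2) ->
  `|std_normal_expect f - trig_normal_mean l|
  <= e + C * (p%:R * normal_second_moment R).
Proof.
move=> f_near_trig; have [trig_int trig_iter] := gauss_mean_trig_eval l.
have [sqr_int sqr_iter] := gauss_mean_eucl_norm_sqr.
have [scaled_int scaled_iter] := gauss_meanZ C sqr_int.
have [cst_int cst_iter] := gauss_mean_cst p e.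
have [sum_int sum_iter] := gauss_meanD cst_int scaled_int.
have := gauss_iter_sandwich trig_int sum_int
  (fun z => f_near_trig (\col_i z i)) (fun=> 0).
by rewrite trig_iter sum_iter cst_iter scaled_iter sqr_iter.
Qed.

End std_normal_expectation.

(** * A criterion for convergence to the standard normal law *)

Lemma ler_truncation (R : realType) (p : nat) (L e B r : R) (u : 'cV[R]_p) :
    0 < L -> 0 <= e -> 0 <= B -> r <= 2 * B -> (eucl_norm u <= L -> r <= e) ->
  r <= e + 2 * B / L ^+ 2 * eucl_norm u ^+ 2.
Proof.
move=> L_gt0 e0 B0 rB r_in; have [/r_in re|/ltW Lu] := leP (eucl_norm u) L.
  by rewrite -[leLHS]addr0 lerD// mulr_ge0 ?sqr_ge0// divr_ge0 ?sqr_ge0// mulr_ge0.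
rewrite -[leLHS]add0r lerD// (le_trans rB)// mulrAC ler_pdivlMr ?exprn_gt0//.
by rewrite ler_wpM2l ?mulr_ge0// lerXn2r// nnegrE ?eucl_norm_ge0// ltW.
Qed.

Lemma truncation_radius (R : realFieldType) (K e : R) : 0 <= K -> 0 < e ->
  exists2 L, 0 < L & K / L ^+ 2 <= e.
Proof.
move=> K0 e_gt0; have Ke0 : 0 <= K / e by rewrite divr_ge0// ltW.
exists (K / e + 1); first by rewrite ltr_wpDl.
rewrite ler_pdivrMr ?exprn_gt0 ?ltr_wpDl//.
have {1}-> : K = e * (K / e) by rewrite mulrC divfK// gt_eqF.
by rewrite ler_wpM2l ?(ltW e_gt0)//; nra.
Qed.

Section trigonometric_criterion.
Context d (T : measurableType d) (R : realType) (P : probability T R) (p : nat).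
Variables (U Z : nat -> T -> 'cV[R]_p) (C : R).
Hypothesis U_meas : forall n j, measurable_fun setT (fun w => U n w j ord0).
Hypothesis U_sqr_int : forall n,
  P.-integrable setT (EFin \o (fun w => eucl_norm (U n w) ^+ 2)).
Hypothesis U_sqr_le : \forall n \near \oo,
  \int[P]_w (eucl_norm (U n w) ^+ 2) <= C.
Hypothesis U_cos_cvg : forall th ph,
  \int[P]_w cos (ph + dotv th (U n w)) @[n --> \oo] -->
  expR (- dotv th th / 2) * cos ph.
Hypothesis Z_near_U : forall L e : R, 0 < e -> \forall n \near \oo,
  forall w, eucl_norm (U n w) <= L -> eucl_norm (Z n w - U n w) <= e.
Implicit Types (f : 'cV[R]_p -> R) (l : seq (trig_term R p)).

Lemma integrable_cos_dotv n th ph :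
  P.-integrable setT (EFin \o (fun w => cos (ph + dotv th (U n w)))).
Proof.
apply: measurable_bounded_integrable => //.
- exact: le_lt_trans (probability_le1 P measurableT) (ltry _).
- apply: measurableT_comp.
    by apply: continuous_measurable_fun => x; exact: continuous_cos.
  apply: measurable_funD => //; under eq_fun do rewrite dotvE.
  by apply: measurable_sum => j; apply: measurable_funM.
exists 1; split; first exact: num_real.
by move=> r r1 w _ /=; exact: le_trans (normr_cos_le1 _) (ltW r1).
Qed.

Lemma expect_trig_eval n l :
  P.-integrable setT (EFin \o (fun w => trig_eval l (U n w))) /\
  \int[P]_w trig_eval l (U n w) =
  \sum_(a <- l) amplitude a *
    \int[P]_w cos (phase a + dotv (frequency a) (U n w)).
Proof.
rewrite /trig_eval; elim: l => [|a l [l_int l_mean]].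
  under eq_fun do rewrite big_nil; rewrite big_nil Rintegral_probability_cst.
  by split=> //; exact: integrable0.
have a_int := integrable_cos_dotv n (frequency a) (phase a).
have Za_int := integrableZl measurableT (amplitude a) a_int.
under eq_fun do rewrite big_cons; rewrite big_cons; split.
  exact: (integrableD measurableT Za_int l_int).
by rewrite RintegralD// l_mean RintegralZl.
Qed.

Lemma expect_trig_cvg l :
  \int[P]_w trig_eval l (U n w) @[n --> \oo] --> trig_normal_mean l.
Proof.
rewrite (funext (fun n => proj2 (expect_trig_eval n l))).
apply: (cvg_big add_continuous) => a _.
by apply: cvgM; [exact: cvg_cst|exact: U_cos_cvg].
Qed.

Lemma expect_trig_approx f l (L B e : R) :
    0 < L -> 0 < e ->
    (forall u, `|f u| <= B) -> (forall u, `|trig_eval l u| <= B) ->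
    (forall u, eucl_norm u <= L + 1 -> `|f u - trig_eval l u| <= e) ->
  \forall n \near \oo,
    `|\int[P]_w f (Z n w) - \int[P]_w trig_eval l (U n w)|
    <= 2 * e + 2 * B / L ^+ 2 * C.
Proof.
move=> L_gt0 e_gt0 f_bound g_bound f_near_g.
have B0 : 0 <= B by apply: le_trans (f_bound 0).
pose lip := \sum_(a <- l) `|amplitude a| * eucl_norm (frequency a).
have lip0 : 0 <= lip by apply: sumr_ge0 => a _; rewrite mulr_ge0 ?eucl_norm_ge0.
pose r := Num.min 1 (e / (lip + 1)).
have r_gt0 : 0 < r by rewrite lt_min ltr01 divr_gt0// ltr_wpDl.
have lip_r : lip * r <= e.
  apply: (@le_trans _ _ ((lip + 1) * (e / (lip + 1)))).
    by rewrite ler_pM ?(ltW r_gt0) ?lerDl// ge_min lexx orbT.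
  by rewrite mulrC divfK// gt_eqF// ltr_wpDl.
near=> n.
have near_n : forall w, eucl_norm (U n w) <= L -> eucl_norm (Z n w - U n w) <= r.
  by near: n; exact: Z_near_U.
have fl_U w : `|f (Z n w) - trig_eval l (U n w)| <=
    2 * e + 2 * B / L ^+ 2 * eucl_norm (U n w) ^+ 2.
  apply: ler_truncation => //; first by rewrite mulr_ge0// ltW.
    apply: le_trans (ler_normB _ _) _.
    by have := f_bound (Z n w); have := g_bound (U n w); lra.
  move=> U_le_L; have ZU_near := near_n w U_le_L.
  rewrite -[f _](subrK (trig_eval l (Z n w))) -addrA mulr2n mulrDl mul1r.
  apply: le_trans (ler_normD _ _) (lerD _ _).
    apply: f_near_g; rewrite -[Z n w](subrK (U n w)) addrC.
    apply: le_trans (ler_eucl_normD _ _) (lerD U_le_L (le_trans ZU_near _)).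
    by rewrite ge_min lexx.
  apply: le_trans (trig_eval_lipschitz _ _ _) (le_trans _ lip_r).
  exact: ler_wpM2l.
have cst_int : P.-integrable setT (EFin \o (fun=> 2 * e)).
  by apply: finite_measure_integrable_cst.
have Zsqr_int := integrableZl measurableT (2 * B / L ^+ 2) (U_sqr_int n).
have bound_int := integrableD measurableT cst_int Zsqr_int.
have [l_int _] := expect_trig_eval n l.
apply: le_trans (Rintegral_sandwich l_int bound_int fl_U) _.
rewrite RintegralD// (RintegralZl _ measurableT (U_sqr_int n)).
rewrite Rintegral_probability_cst lerD2l.
apply: ler_wpM2l; first by rewrite divr_ge0 ?sqr_ge0// mulr_ge0.
by near: n; exact: U_sqr_le.
Unshelve. all: by end_near. Qed.

Theorem cvg_dist_std_normal_trig : cvg_dist_std_normal P Z.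
Proof.
move=> f f_cont [B f_bound]; have B0 : 0 <= B by apply: le_trans (f_bound 0).
have expectE n : fine ('E_P[f \o Z n])%E = \int[P]_w f (Z n w).
  by rewrite unlock.
rewrite (funext expectE); apply/cvgrPdist_le => e e_gt0.
pose m := p%:R * normal_second_moment R.
have m0 : 0 <= m by rewrite mulr_ge0// normal_second_moment_ge0.
have e6_gt0 : 0 < e / 6 by rewrite divr_gt0.
have [|L L_gt0 radius] := @truncation_radius _ (2 * B * (`|C| + m)) _ _ e6_gt0.
  by rewrite !mulr_ge0// addr_ge0.
have radius_le c : c <= `|C| + m -> 2 * B / L ^+ 2 * c <= e / 6.
  move=> c_le; apply: le_trans radius.
  by rewrite mulrAC ler_wpM2r ?invr_ge0 ?sqr_ge0// ler_wpM2l// mulr_ge0.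
have L1_gt0 : 0 < L + 1 by rewrite addr_gt0.
have [g [[l gl] gB fg]] := is_trig_approx f_cont f_bound L1_gt0 e6_gt0.
have trig_bound u : `|trig_eval l u| <= B by rewrite -gl.
have f_near_trig u : eucl_norm u <= L + 1 -> `|f u - trig_eval l u| <= e / 6.
  move=> u_le_L; rewrite -gl; apply: fg => j.
  exact: le_trans (ler_coord_eucl_norm u j) u_le_L.
have normal_fl : `|std_normal_expect f - trig_normal_mean l| <=
    e / 6 + 2 * B / L ^+ 2 * m.
  apply: std_normal_expect_trig => u; apply: ler_truncation => //; first exact: ltW.
    apply: le_trans (ler_normB _ _) _.
    by have := f_bound u; have := trig_bound u; lra.
  by move=> u_le_L; apply: f_near_trig; rewrite (le_trans u_le_L)// lerDl.
have mC : m <= `|C| + m by rewrite lerDr.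
have CC : C <= `|C| + m by rewrite (le_trans (ler_norm C))// lerDl.
have /cvgrPdist_le/(_ _ e6_gt0) U_near := @expect_trig_cvg l.
near=> n.
have mean_f_near : `|\int[P]_w f (Z n w) - \int[P]_w trig_eval l (U n w)| <=
    2 * (e / 6) + 2 * B / L ^+ 2 * C by near: n; exact: expect_trig_approx.
have mean_trig_near :
  `|trig_normal_mean l - \int[P]_w trig_eval l (U n w)| <= e / 6.
  by near: n.
have := radius_le _ mC; have := radius_le _ CC.
move: mean_f_near mean_trig_near normal_fl; rewrite !ler_norml; lra.
Unshelve. all: by end_near. Qed.

End trigonometric_criterion.

(** * Expectations over independent Bernoulli responses *)

Section bernoulli_expectation.
Context d (T : measurableType d) (R : realType) (P : probability T R).
Variables (Y : nat -> T -> R) (q : nat -> R).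
Hypothesis Y_meas : forall i, measurable_fun setT (Y i).
Hypothesis Y01 : forall i w, Y i w = 0 \/ Y i w = 1.
Hypothesis P_success : forall i, P (Y i @^-1` [set 1]) = (q i)%:E.
Hypothesis Y_indep : mutually_independent_rv P Y.
Implicit Types (y : nat -> R) (k : nat).

Lemma measurable_response_eq i (b : R) : measurable (Y i @^-1` [set b]).
Proof.
by rewrite -[X in measurable X]setTI; apply: Y_meas => //; exact: measurable_set1.
Qed.

Lemma success_prob01 i : 0 <= q i <= 1.
Proof.
rewrite -!lee_fin -P_success measure_ge0/=.
exact/probability_le1/measurable_response_eq.
Qed.

Lemma P_failure i : P (Y i @^-1` [set 0]) = (1 - q i)%:E.
Proof.
have -> : Y i @^-1` [set 0] = ~` (Y i @^-1` [set 1]).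
  apply/seteqP; split=> w /=; last by case: (Y01 i w).
  by move=> ->; apply/eqP; rewrite eq_sym oner_eq0.
by rewrite probability_setC ?P_success ?EFinB//; exact: measurable_response_eq.
Qed.

Definition depends_below n (G : (nat -> R) -> R) :=
  forall y z, (forall j, (j < n)%N -> y j = z j) -> G y = G z.

(* A 0-1 value is the mean of a degenerate Bernoulli variable. *)
Lemma bern_mean_response w n (G : (nat -> R) -> R) y :
  bern_mean (Y ^~ w) n G y = G (fun j => if (j < n)%N then Y j w else y j).
Proof.
elim: n y => [//|n IHn] y /=; rewrite !IHn.
have updateE (b : R) : Y n w = b ->
    (fun j => if (j < n)%N then Y j w else update y n b j) =
    (fun j => if (j < n.+1)%N then Y j w else y j).
  move=> Yb; apply/funext => j; rewrite /update ltnS [(j <= n)%N]leq_eqVlt.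
  by case: eqVneq => [->|_] //=; rewrite ltnn Yb.
by case: (Y01 n w) => Yn; rewrite (updateE _ Yn) Yn; ring.
Qed.

Lemma measurable_bern_mean_response n G y :
  measurable_fun setT (fun w => bern_mean (Y ^~ w) n G y).
Proof.
elim: n y => [|n IHn] y /=; first exact: measurable_cst.
apply: measurable_funD; apply: measurable_funM => //.
by apply: measurable_funB => //; exact: measurable_cst.
Qed.

Lemma bounded_bern_mean_response n G y :
  exists C : R, forall w, `|bern_mean (Y ^~ w) n G y| <= C.
Proof.
elim: n y => [|n IHn] y /=; first by exists `|G y|.
have [C1 le_C1] := IHn (update y n 1); have [C0 le_C0] := IHn (update y n 0).
exists (C1 + C0) => w; have := le_C1 w; have := le_C0 w; rewrite !ler_norml.
by case: (Y01 n w) => ->; lra.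
Qed.

Variables (n : nat) (G : (nat -> R) -> R).
Hypothesis G_below : depends_below n G.

Lemma bern_mean_responseE w y : bern_mean (Y ^~ w) n G y = G (Y ^~ w).
Proof. by rewrite bern_mean_response; apply: G_below => j ->. Qed.

Lemma integrable_responses : P.-integrable setT (EFin \o (fun w => G (Y ^~ w))).
Proof.
rewrite -(funext (bern_mean_responseE ^~ (fun=> 0))).
apply: measurable_bounded_integrable => //.
- exact: le_lt_trans (probability_le1 P measurableT) (ltry _).
- exact: measurable_bern_mean_response.
have [C le_C] := bounded_bern_mean_response n G (fun=> 0).
exists C; split; first exact: num_real.
by move=> r Cr w _ /=; exact: le_trans (le_C w) (ltW Cr).
Qed.

Definition responses_from k y : set T :=
  [set w | forall i, i \in index_iota k n -> [set y i] (Y i w)].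

Lemma measurable_responses_from k y : measurable (responses_from k y).
Proof.
rewrite (_ : responses_from k y = \bigcap_i
    (if i \in index_iota k n then Y i @^-1` [set y i] else setT)); last first.
  apply/seteqP; split=> [w Yy i _|w Yy i ik]; first by case: ifPn => // /Yy.
  by have := Yy i I; rewrite ik.
by apply: bigcapT_measurable => i; case: ifP => _ //; exact: measurable_response_eq.
Qed.

Lemma P_responses_from_update k y (b : R) : (k < n)%N ->
  P (responses_from k (update y k b)) =
  (P (Y k @^-1` [set b]) * P (responses_from k.+1 y))%E.
Proof.
move=> kn; rewrite (Y_indep (B := fun i => [set update y k b i])) ?iota_uniq//.
rewrite (Y_indep (B := fun i => [set y i])) ?iota_uniq//.
rewrite /index_iota -(subnSK kn) /= big_cons update_same; congr (_ * _)%E.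
rewrite !big_seq; apply: eq_bigr => i; rewrite mem_iota => /andP[ki _].
by rewrite /update gtn_eqF.
Qed.

Lemma responses_fromS k y : (k < n)%N ->
  responses_from k.+1 y =
  responses_from k (update y k 1) `|` responses_from k (update y k 0).
Proof.
move=> kn; apply/seteqP; split=> [w Yy|w].
  have Yk b : Y k w = b -> responses_from k (update y k b) w.
    move=> Yb i; rewrite mem_index_iota => /andP[ki i_n] /=.
    rewrite /update; case: eqVneq => [->//|ik]; apply: Yy.
    by rewrite mem_index_iota i_n ltn_neqAle eq_sym ik ki.
  by case: (Y01 k w) => ?; [right|left]; exact: Yk.
have sub b : responses_from k (update y k b) `<=` responses_from k.+1 y.
  move=> v Yv i; rewrite mem_index_iota => /andP[ki i_n].
  by have := Yv i; rewrite mem_index_iota (ltnW ki) i_n /update gtn_eqF//; apply.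
by case=> /sub.
Qed.

Lemma disjoint_responses_from_update k y : (k < n)%N ->
  [disjoint responses_from k (update y k 1) & responses_from k (update y k 0)].
Proof.
move=> kn; apply/disj_set2P/seteqP; split=> // w [/(_ k) Y1 /(_ k) Y0].
have k_in : k \in index_iota k n by rewrite mem_index_iota leqnn.
have := Y1 k_in; have := Y0 k_in; rewrite /= !update_same => ->.
by move/eqP; rewrite eq_sym oner_eq0.
Qed.

Lemma integral_responses_from k y : (k <= n)%N ->
  (\int[P]_(w in responses_from k y) (G (Y ^~ w))%:E
   = P (responses_from k y) * (bern_mean q k G y)%:E)%E.
Proof.
have GY_int m z :
    P.-integrable (responses_from m z) (EFin \o (fun w => G (Y ^~ w))).
  apply: integrableS integrable_responses => //.
  exact: measurable_responses_from.
elim: k y => [|k IHk] y kn /=.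
  rewrite (eq_integral (fun=> (G y)%:E)) => [|w]; last first.
    rewrite inE => Yy; congr EFin; apply: G_below => j jn.
    by apply: Yy; rewrite mem_index_iota.
  by rewrite integral_cst; [exact: muleC|exact: measurable_responses_from].
have GY_meas : measurable_fun (responses_from k.+1 y) (fun w => G (Y ^~ w)).
  by have /integrableP[/measurable_EFinP] := GY_int k.+1 y.
rewrite (responses_fromS y kn) integral_setU_EFin//; first last.
- exact: disjoint_responses_from_update.
- by rewrite -(responses_fromS y kn).
- exact: measurable_responses_from.
- exact: measurable_responses_from.
rewrite -(responses_fromS y kn) !(IHk _ (ltnW kn)).
rewrite !(P_responses_from_update _ _ kn) P_success P_failure.
have : P (responses_from k.+1 y) \is a fin_num.
  by apply: fin_num_measure; exact: measurable_responses_from.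
case: (P (responses_from k.+1 y)) => //= r _.
by rewrite -!EFinM -EFinD; congr EFin; ring.
Qed.

Lemma expect_responses y : \int[P]_w G (Y ^~ w) = bern_mean q n G y.
Proof.
have := @integral_responses_from n y (leqnn n).
have -> : responses_from n y = setT.
  by apply/seteqP; split=> // w _ i; rewrite mem_index_iota leqNgt andNb.
by rewrite /Rintegral [P setT]probability_setT mul1e => ->.
Qed.

End bernoulli_expectation.

(** * The log-likelihood ratio of an isotropic logistic design *)

Definition maximizer (R : realType) (A : Type) (F : A -> R) (b : A) :=
  forall a, F a <= F b.

Section isotropic_design.
Variables (R : realType) (p n : nat).
Variables (q : nat -> R) (v : nat -> 'cV[R]_p) (M : R).
Implicit Types (h th u : 'cV[R]_p) (y : nat -> R).

Definition isotropic := forall h,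
  \sum_(i < n) bernoulli_variance (q i) * dotv h (v i) ^+ 2 = dotv h h.

Definition cubic_moment : R :=
  \sum_(i < n) bernoulli_variance (q i) * eucl_norm (v i) ^+ 3.

Definition lindeberg_sum (e : R) : R :=
  \sum_(i < n) bernoulli_variance (q i) * eucl_norm (v i) ^+ 2
    * (if e <= eucl_norm (v i) then 1 else 0).

Definition score y : 'cV[R]_p := \sum_(i < n) (y i - q i) *: v i.

(* For [v i = J^{-1/2} x_i], this is the log-likelihood at
   [beta0 + J^{-1/2} h] minus the one at [beta0]. *)
Definition loglik_ratio y h : R :=
  \sum_(i < n) (y i * dotv h (v i) - ln (bernoulli_mgf (q i) (dotv h (v i)))).

Hypothesis q01 : forall i, 0 <= q i <= 1.
Hypothesis v_isotropic : isotropic.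
Hypothesis v_le : forall i, (i < n)%N -> eucl_norm (v i) <= M.

Let variance_ge0 i : 0 <= bernoulli_variance (q i).
Proof. exact: bernoulli_variance_ge0. Qed.

Lemma cubic_moment_ge0 : 0 <= cubic_moment.
Proof. by apply: sumr_ge0 => i _; rewrite mulr_ge0// exprn_ge0// eucl_norm_ge0. Qed.

Lemma isotropic_trace :
  \sum_(i < n) bernoulli_variance (q i) * eucl_norm (v i) ^+ 2 = p%:R.
Proof.
under eq_bigr do rewrite eucl_norm_sqr dotvE mulr_sumr; rewrite exchange_big/=.
transitivity (\sum_(j < p) (1 : R)); last by rewrite sumr_const card_ord.
apply: eq_bigr => j _; have := v_isotropic (delta_mx j ord0).
rewrite dotv_delta_mx_id => <-.
by apply: eq_bigr => i _; rewrite dotv_delta_mx expr2.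
Qed.

Lemma cubic_moment_le (e : R) : 0 <= e -> 0 <= M ->
  cubic_moment <= e * p%:R + M * lindeberg_sum e.
Proof.
move=> e0 M0; rewrite -isotropic_trace !mulr_sumr -big_split/=.
apply: ler_sum => i _; have vi := v_le (ltn_ord i).
have b0 : 0 <= bernoulli_variance (q i) * eucl_norm (v i) ^+ 2.
  by rewrite mulr_ge0// sqr_ge0.
rewrite [_ ^+ 3]exprSr mulrA; move: b0; set b := _ * _ ^+ 2 => b0.
rewrite [leLHS]mulrC; case: (leP e) => [_|/ltW v_small].
  by rewrite mulr1 ler_wpDl ?ler_wpM2r// mulr_ge0.
by rewrite !mulr0 addr0 ler_wpM2r.
Qed.

Lemma dotv_score th y :
  dotv th (score y) = centered_sum q (fun i => dotv th (v i)) n y.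
Proof. by rewrite dotv_sumr; apply: eq_bigr => i _; rewrite dotvZr. Qed.

Lemma bern_mean_eucl_norm_score_sqr y :
  bern_mean q n (fun y => eucl_norm (score y) ^+ 2) y = p%:R.
Proof.
have score_sqrE z : eucl_norm (score z) ^+ 2 =
    \sum_(j < p)
      (0 + centered_sum q (fun i => dotv (delta_mx j ord0) (v i)) n z) ^+ 2.
  rewrite eucl_norm_sqr dotvE; apply: eq_bigr => j _.
  by rewrite add0r -dotv_score dotv_delta_mx expr2.
rewrite (eq_bern_mean _ _ _ score_sqrE) bern_mean_sum.
transitivity (\sum_(j < p) (1 : R)); last by rewrite sumr_const card_ord.
apply: eq_bigr => j _; rewrite (bern_mean_centered_sum_sqr _ _ (c := fun=> 0))//.
by rewrite expr0n/= add0r [LHS]v_isotropic dotv_delta_mx_id.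
Qed.

Lemma bern_mean_cos_score th (ph : R) y :
  `|bern_mean q n (fun y => cos (ph + dotv th (score y))) y
     - expR (- dotv th th / 2) * cos ph|
  <= cubic_moment * (eucl_norm th ^+ 3 + M * eucl_norm th ^+ 4).
Proof.
under eq_bern_mean do rewrite dotv_score; rewrite -v_isotropic.
apply: le_trans (bern_mean_cos_centered_sum _ (c := fun=> ph) _ q01 _) _ => //.
rewrite mulr_suml; apply: ler_sum => i _.
rewrite -[leLHS]mulrA -[leRHS]mulrA ler_wpM2l//.
have v0 := eucl_norm_ge0 (v i); have th0 := eucl_norm_ge0 th.
have vi := v_le (ltn_ord i); have cs := cauchy_schwarz th (v i).
rewrite -(real_normK (num_real (dotv th (v i)))).
move: cs th0 v0 vi; set a := eucl_norm th; set b := eucl_norm (v i) => cs a0 b0 bM.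
apply: (@le_trans _ _ ((a * b) ^+ 2 * (a * b + (a * b) ^+ 2))).
  by rewrite ler_pM ?addr_ge0 ?sqr_ge0 ?lerD ?lerXn2r ?nnegrE ?mulr_ge0.
rewrite [leLHS](_ : _ = b ^+ 3 * (a ^+ 3 + b * a ^+ 4)); last by ring.
by rewrite ler_wpM2l ?exprn_ge0// lerD2l ler_wpM2r ?exprn_ge0.
Qed.

Lemma loglik_ratio_quadratic y h (r : R) : 0 <= M -> eucl_norm h <= r ->
  `|loglik_ratio y h - (dotv h (score y) - dotv h h / 2)|
  <= expR (M * r) * cubic_moment * r ^+ 3.
Proof.
move=> M0 hr; have r0 : 0 <= r by exact: le_trans (eucl_norm_ge0 h) hr.
have -> : loglik_ratio y h - (dotv h (score y) - dotv h h / 2) =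
  - \sum_(i < n) (ln (bernoulli_mgf (q i) (dotv h (v i))) - q i * dotv h (v i)
      - bernoulli_variance (q i) * dotv h (v i) ^+ 2 / 2).
  rewrite dotv_score -v_isotropic mulr_suml -!sumrB -sumrN.
  by apply: eq_bigr => i _; ring.
rewrite normrN; apply: le_trans (ler_norm_sum _ _ _) _.
rewrite mulr_sumr mulr_suml; apply: ler_sum => i _.
have hv : `|dotv h (v i)| <= r * eucl_norm (v i).
  apply: le_trans (cauchy_schwarz _ _) _.
  by rewrite ler_wpM2r ?eucl_norm_ge0.
apply: le_trans (ln_bernoulli_mgf_taylor2 _ (q01 i)) _.
rewrite [leRHS](_ : _ = bernoulli_variance (q i) * expR (M * r)
  * (r * eucl_norm (v i)) ^+ 3); last by ring.
apply: ler_pM; [by rewrite mulr_ge0 ?expR_ge0|exact: exprn_ge0| |].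
  by rewrite ler_wpM2l// ler_expR (le_trans hv)// mulrC ler_wpM2r// v_le.
by rewrite lerXn2r// nnegrE mulr_ge0 ?eucl_norm_ge0.
Qed.

Lemma loglik_ratio_concave y h h' (a : R) : 0 <= a <= 1 ->
  (1 - a) * loglik_ratio y h + a * loglik_ratio y h'
  <= loglik_ratio y ((1 - a) *: h + a *: h').
Proof.
move=> /andP[a0 a1]; rewrite !mulr_sumr -big_split/=.
apply: ler_sum => i _; rewrite dotvDl !dotvZl.
set s := dotv h (v i); set t := dotv h' (v i); set z := (1 - a) * s + a * t.
have tangent_s := ln_bernoulli_mgf_ge_tangent z s (q01 i).
have tangent_t := ln_bernoulli_mgf_ge_tangent z t (q01 i).
have onem_a0 : 0 <= 1 - a by rewrite subr_ge0.
have := lerD (ler_wpM2l onem_a0 tangent_s) (ler_wpM2l a0 tangent_t).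
set lz := ln (bernoulli_mgf _ z); set D := bernoulli_tilt _ _.
have -> : (1 - a) * (lz + D * (s - z)) + a * (lz + D * (t - z)) = lz.
  by rewrite /z; ring.
by rewrite /z; lra.
Qed.

Lemma continuous_loglik_ratio y :
  continuous (fun z : 'rV[R]_p => loglik_ratio y z^T).
Proof.
have dotv_cont i : continuous (fun z : 'rV[R]_p => dotv z^T (v i)).
  rewrite (_ : (fun z => _) =
    fun z : 'rV[R]_p => \sum_(j < p) z ord0 j * v i j ord0).
    apply: (continuous_big add_continuous) => j _ z.
    apply: (@continuous_comp _ _ _ (fun z : 'rV[R]_p => z ord0 j)
      ( *%R^~ (v i j ord0))).
      exact: coord_continuous.
    exact: mulrr_continuous.
  by apply/funext => z; rewrite dotvE; apply: eq_bigr => j _; rewrite mxE.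
apply: (continuous_big add_continuous) => i _ z.
apply: (@continuous_comp _ _ _ (fun z : 'rV[R]_p => dotv z^T (v i))
  (fun t => y i * t - ln (bernoulli_mgf (q i) t))); first exact: dotv_cont.
apply: cvgB; first exact: mulrl_continuous.
exact: (is_derive_continuous (fun t => is_derive_ln_bernoulli_mgf t (q01 i))).
Qed.

Section localisation.
Variables (y : nat -> R) (r e : R).
Hypothesis M0 : 0 <= M.
Hypothesis e_gt0 : 0 < e.
Hypothesis score_le : eucl_norm (score y) + e <= r.
Hypothesis remainder_le : expR (M * r) * cubic_moment * r ^+ 3 <= e ^+ 2 / 8.

Lemma loglik_ratio_sphere h : eucl_norm (h - score y) = e ->
  loglik_ratio y h < loglik_ratio y (score y).
Proof.
move=> h_sphere.
have complete_square u : dotv u (score y) - dotv u u / 2 =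
    dotv (score y) (score y) / 2 - dotv (u - score y) (u - score y) / 2.
  by rewrite !dotvBl !dotvBr (dotvC (score y) u); field.
have h_le : eucl_norm h <= r.
  rewrite -(subrK (score y) h); apply: le_trans (ler_eucl_normD _ _) _.
  by rewrite h_sphere addrC.
have s_le : eucl_norm (score y) <= r by apply: le_trans score_le; rewrite lerDl ltW.
have := le_trans (loglik_ratio_quadratic y M0 h_le) remainder_le.
have := le_trans (loglik_ratio_quadratic y M0 s_le) remainder_le.
rewrite (complete_square h) -(eucl_norm_sqr (h - score y)) h_sphere.
have := exprn_gt0 2 e_gt0; rewrite !ler_norml; lra.
Qed.

Lemma loglik_ratio_outside h : e < eucl_norm (h - score y) ->
  loglik_ratio y h < loglik_ratio y (score y).
Proof.
set s := score y => h_far.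
have far_gt0 : 0 < eucl_norm (h - s) by exact: lt_trans h_far.
pose a := e / eucl_norm (h - s).
have a0 : 0 <= a by rewrite divr_ge0// ltW.
have a1 : a <= 1 by rewrite ler_pdivrMr// mul1r ltW.
have sphere : eucl_norm ((1 - a) *: s + a *: h - s) = e.
  rewrite (_ : _ - s = a *: (h - s)).
    by rewrite eucl_normZ ger0_norm// divfK// gt_eqF.
  by rewrite scalerBl scale1r scalerBr addrAC [s - _ - s]addrAC subrr add0r addrC.
have := loglik_ratio_sphere sphere; rewrite -/s => lt_s.
have concave := @loglik_ratio_concave y s h a (introT andP (conj a0 a1)).
rewrite ltNge; apply/negP => le_sh.
have := ler_wpM2l a0 le_sh; lra.
Qed.

Lemma loglik_ratio_maximizer_exists : exists b, maximizer (loglik_ratio y) b.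
Proof.
set s := score y.
pose I j := `[s j ord0 - e, s j ord0 + e]%classic.
pose cube : set 'rV[R]_p := [set z | forall j, I j (z ord0 j)].
have cube_compact : compact cube := rV_compact (fun=> @segment_compact _ _ _).
have cube_s : cube s^T.
  by move=> j; rewrite /I/= in_itv/= mxE; have := ltW e_gt0; lra.
have cube_neq0 : cube !=set0 by exists s^T.
have [b _ max_b] := compact_EVT_max cube_neq0 cube_compact
  (continuous_subspaceT (@continuous_loglik_ratio y)).
exists b^T => h; have [cube_h|] := pselect (cube h^T).
  by rewrite -[h in leLHS]trmxK; apply: max_b; rewrite inE.
move=> /existsNP[j]; rewrite /I/= in_itv/= mxE => /negP h_out.
have s_le_b : loglik_ratio y s <= loglik_ratio y b^T.
  by rewrite -[s in leLHS]trmxK; apply: max_b; rewrite inE.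
apply: le_trans s_le_b; apply/ltW/loglik_ratio_outside.
apply: lt_le_trans (ler_coord_eucl_norm (h - s) j).
by rewrite ltNge; apply: contra h_out; rewrite !mxE ler_norml; lra.
Qed.

Lemma loglik_ratio_maximizer_near b : maximizer (loglik_ratio y) b ->
  eucl_norm (b - score y) <= e.
Proof.
move=> max_b; rewrite leNgt; apply/negP => /loglik_ratio_outside.
by rewrite ltNge max_b.
Qed.

End localisation.
End isotropic_design.

(** * Normalisation by the information matrix *)

Section symmetric_square_root.
Variables (R : realType) (p : nat) (S A : 'M[R]_p).
Hypothesis A_unit : A \in unitmx.
Hypothesis S_sqrt : is_sym_sqrt S A.
Implicit Types u h : 'cV[R]_p.

Lemma sym_sqrt_unitmx : S \in unitmx.
Proof.
by have [_ [_ SS]] := S_sqrt; move: A_unit; rewrite -SS unitmx_mul => /andP[].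
Qed.

Lemma sym_sqrt_tr_invmx : (invmx S)^T = invmx S.
Proof. by have [S_sym _] := S_sqrt; rewrite trmx_inv S_sym. Qed.

Lemma sym_sqrt_mulKmx h : invmx S *m (S *m h) = h.
Proof. by rewrite mulmxA mulVmx ?mul1mx// sym_sqrt_unitmx. Qed.

Lemma sym_sqrt_mulVKmx h : S *m (invmx S *m h) = h.
Proof. by rewrite mulmxA mulmxV ?mul1mx// sym_sqrt_unitmx. Qed.

Lemma sym_sqrt_dotv h u : dotv (S *m h) (invmx S *m u) = dotv h u.
Proof. by rewrite dotv_mulmx; have [-> _] := S_sqrt; rewrite sym_sqrt_mulVKmx. Qed.

Lemma sym_sqrt_invmx_mul h : A *m (invmx S *m h) = S *m h.
Proof. by have [_ [_ <-]] := S_sqrt; rewrite -mulmxA sym_sqrt_mulVKmx. Qed.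

Lemma sym_sqrt_quadratic_form u :
  (u^T *m invmx A *m u) ord0 ord0 = eucl_norm (invmx S *m u) ^+ 2.
Proof.
rewrite eucl_norm_sqr dotv_mulmx sym_sqrt_tr_invmx /dotv -mulmxA.
congr ((_ *m _) _ _).
rewrite -[u in LHS]sym_sqrt_mulVKmx -[invmx S *m u in LHS]sym_sqrt_mulVKmx.
by rewrite -[S *m (S *m _)]sym_sqrt_invmx_mul sym_sqrt_mulKmx mulKmx.
Qed.

End symmetric_square_root.

Section logistic_likelihood.
Variables (R : realType) (p n : nat).
Variables (x : nat -> 'cV[R]_p) (beta0 : 'cV[R]_p) (S : 'M[R]_p).
Let q i := logistic (dotv beta0 (x i)).
Let J := \sum_(i < n) bernoulli_variance (q i) *: (x i *m (x i)^T).
Hypothesis J_unit : J \in unitmx.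
Hypothesis S_sqrt : is_sym_sqrt S J.

Lemma dotv_information h :
  dotv h (J *m h) = \sum_(i < n) bernoulli_variance (q i) * dotv h (x i) ^+ 2.
Proof.
rewrite mulmx_suml dotv_sumr; apply: eq_bigr => i _.
rewrite -scalemxAl dotvZr -mulmxA [(x i)^T *m h]mx11_scalar mul_mx_scalar dotvZr.
by rewrite -/(dotv (x i) h) dotvC expr2.
Qed.

Lemma isotropic_normalized : isotropic n q (fun i => invmx S *m x i).
Proof.
move=> h.
have dotv_h i : dotv h (invmx S *m x i) = dotv (invmx S *m h) (x i).
  by rewrite -{1}[h](sym_sqrt_mulVKmx J_unit S_sqrt) (sym_sqrt_dotv J_unit S_sqrt).
under eq_bigr do rewrite dotv_h.
by rewrite -dotv_information (sym_sqrt_invmx_mul J_unit S_sqrt) dotvC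
  (sym_sqrt_dotv J_unit S_sqrt).
Qed.

Lemma ln_logistic (t : R) : ln (logistic t) = t - ln (1 + expR t).
Proof. by rewrite /logistic ln_div ?posrE ?addr_gt0 ?expR_gt0// expRK. Qed.

Lemma ln_onem_logistic (t : R) : ln (1 - logistic t) = - ln (1 + expR t).
Proof.
have e_gt0 : 0 < 1 + expR t by rewrite addr_gt0 ?expR_gt0.
rewrite -lnV ?posrE//; congr ln.
by rewrite /logistic; field; rewrite gt_eqF.
Qed.

Lemma logistic_loglik_shift (y s t : R) :
  y * ln (logistic (s + t)) + (1 - y) * ln (1 - logistic (s + t)) =
  y * ln (logistic s) + (1 - y) * ln (1 - logistic s)
  + (y * t - ln (bernoulli_mgf (logistic s) t)).
Proof.
have e_gt0 a : 0 < 1 + expR a :> R by rewrite addr_gt0 ?expR_gt0.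
have -> : bernoulli_mgf (logistic s) t = (1 + expR (s + t)) / (1 + expR s).
  by rewrite /bernoulli_mgf expRD /logistic; field; rewrite gt_eqF.
by rewrite ln_div ?posrE// !ln_logistic !ln_onem_logistic; ring.
Qed.

Lemma loglik_shift y b : loglik x n b y = loglik x n beta0 y
  + loglik_ratio n q (fun i => invmx S *m x i) y (S *m (b - beta0)).
Proof.
rewrite -big_split/=; apply: eq_bigr => i _.
rewrite (sym_sqrt_dotv J_unit S_sqrt) -logistic_loglik_shift.
by rewrite -dotvDl subrKC.
Qed.

Lemma maximizer_loglik y b : maximizer (loglik x n ^~ y) b <->
  maximizer (loglik_ratio n q (fun i => invmx S *m x i) y) (S *m (b - beta0)).
Proof.
split=> max_b h.
  have := max_b (invmx S *m h + beta0); rewrite loglik_shift [leRHS]loglik_shift.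
  by rewrite addrK (sym_sqrt_mulVKmx J_unit S_sqrt) lerD2l.
by rewrite /= loglik_shift [leRHS]loglik_shift lerD2l.
Qed.

Lemma normalized_mle y b :
    ((exists a, maximizer (loglik x n ^~ y) a) -> maximizer (loglik x n ^~ y) b) ->
    (exists h, maximizer (loglik_ratio n q (fun i => invmx S *m x i) y) h) ->
  maximizer (loglik_ratio n q (fun i => invmx S *m x i) y) (S *m (b - beta0)).
Proof.
move=> mle [h max_h]; apply/maximizer_loglik/mle; exists (invmx S *m h + beta0).
by apply/maximizer_loglik; rewrite addrK (sym_sqrt_mulVKmx J_unit S_sqrt).
Qed.

End logistic_likelihood.

(** * Asymptotic normality *)

Section asymptotic_normality.
Context d (T : measurableType d) (R : realType) (P : probability T R) (p : nat).
Variables (q : nat -> R) (v : nat -> nat -> 'cV[R]_p) (M : R).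
Variables (Y : nat -> T -> R) (Z : nat -> T -> 'cV[R]_p).
Hypothesis Y_meas : forall i, measurable_fun setT (Y i).
Hypothesis Y01 : forall i w, Y i w = 0 \/ Y i w = 1.
Hypothesis P_success : forall i, P (Y i @^-1` [set 1]) = (q i)%:E.
Hypothesis Y_indep : mutually_independent_rv P Y.
Hypothesis v_isotropic : \forall n \near \oo, isotropic n q (v n).
Hypothesis M0 : 0 <= M.
Hypothesis v_le : \forall n \near \oo,
  forall i, (i < n)%N -> eucl_norm (v n i) <= M.
Hypothesis lindeberg : forall e : R, 0 < e ->
  lindeberg_sum n q (v n) e @[n --> \oo] --> 0.
Hypothesis Z_max : \forall n \near \oo, forall w,
  (exists h, maximizer (loglik_ratio n q (v n) (Y ^~ w)) h) ->
  maximizer (loglik_ratio n q (v n) (Y ^~ w)) (Z n w).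

Let q01 : forall i, 0 <= q i <= 1.
Proof. exact: success_prob01 Y_meas P_success. Qed.

Let U n w := score n q (v n) (Y ^~ w).

Lemma cubic_moment_cvg0 : cubic_moment n q (v n) @[n --> \oo] --> 0.
Proof.
apply/cvgr0Pnorm_le => e e_gt0.
pose t := e / (2 * (p%:R + 1)).
have t_gt0 : 0 < t by rewrite divr_gt0// mulr_gt0// ltr_wpDl.
have tp : t * p%:R <= e / 2.
  rewrite /t invfM mulrA -[leRHS]mulr1 -mulrA ler_wpM2l ?divr_ge0 ?(ltW e_gt0)//.
  by rewrite mulrC ler_pdivrMr ?ltr_wpDl// mul1r lerDl.
have M_lindeberg : M * lindeberg_sum n q (v n) t @[n --> \oo] --> 0.
  rewrite -[X in _ --> X](mulr0 M).
  by apply: cvgM; [exact: cvg_cst|exact: lindeberg].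
have e2_gt0 : 0 < e / 2 by rewrite divr_gt0.
move/cvgr0Pnorm_le : M_lindeberg => /(_ _ e2_gt0) M_lindeberg.
near=> n; rewrite ger0_norm ?cubic_moment_ge0//.
have iso_n : isotropic n q (v n) by near: n.
have v_le_n : forall i, (i < n)%N -> eucl_norm (v n i) <= M by near: n.
have L_n : `|M * lindeberg_sum n q (v n) t| <= e / 2 by near: n.
apply: le_trans (cubic_moment_le q01 iso_n v_le_n (ltW t_gt0) M0) _.
by move: L_n; rewrite ler_norml; lra.
Unshelve. all: by end_near. Qed.

Lemma depends_below_score n (G : 'cV[R]_p -> R) :
  depends_below n (fun y => G (score n q (v n) y)).
Proof. by move=> y z yz; congr G; apply: eq_bigr => i _; rewrite yz. Qed.

Lemma expect_score n (G : 'cV[R]_p -> R) y :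
  \int[P]_w G (U n w) = bern_mean q n (fun y => G (score n q (v n) y)) y.
Proof.
exact: (expect_responses Y_meas Y01 P_success Y_indep
  (@depends_below_score n G)).
Qed.

Lemma score_cos_cvg th ph :
  \int[P]_w cos (ph + dotv th (U n w)) @[n --> \oo] -->
  expR (- dotv th th / 2) * cos ph.
Proof.
pose K := eucl_norm th ^+ 3 + M * eucl_norm th ^+ 4.
have bound_cvg0 : cubic_moment n q (v n) * K @[n --> \oo] --> 0.
  rewrite -[X in _ --> X](mul0r K).
  by apply: cvgM; [exact: cubic_moment_cvg0|exact: cvg_cst].
apply/cvgrPdist_le => e e_gt0.
move/cvgrPdist_le : bound_cvg0 => /(_ _ e_gt0) bound_le.
near=> n; have : `|0 - cubic_moment n q (v n) * K| <= e by near: n.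
rewrite sub0r normrN => /(le_trans (ler_norm _)); apply: le_trans; rewrite distrC.
have iso_n : isotropic n q (v n) by near: n.
have v_le_n : forall i, (i < n)%N -> eucl_norm (v n i) <= M by near: n.
rewrite (@expect_score n (fun u => cos (ph + dotv th u)) (fun=> 0)).
exact: bern_mean_cos_score.
Unshelve. all: by end_near. Qed.

Lemma maximizer_near_score (L e : R) : 0 < e -> \forall n \near \oo,
  forall w, eucl_norm (U n w) <= L -> eucl_norm (Z n w - U n w) <= e.
Proof.
move=> e_gt0; pose r := L + e.
have remainder_cvg0 :
    expR (M * r) * cubic_moment n q (v n) * r ^+ 3 @[n --> \oo] --> 0.
  rewrite [X in _ --> X](_ : 0 = expR (M * r) * 0 * r ^+ 3); last first.
    by rewrite mulr0 mul0r.
  apply: cvgM; last exact: cvg_cst.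
  by apply: cvgM; [exact: cvg_cst|exact: cubic_moment_cvg0].
have e8_gt0 : 0 < e ^+ 2 / 8 by rewrite divr_gt0 ?exprn_gt0.
move/cvgr0Pnorm_le : remainder_cvg0 => /(_ _ e8_gt0) remainder_small.
near=> n.
have iso_n : isotropic n q (v n) by near: n.
have v_le_n : forall i, (i < n)%N -> eucl_norm (v n i) <= M by near: n.
have remainder_le : expR (M * r) * cubic_moment n q (v n) * r ^+ 3 <= e ^+ 2 / 8.
  by apply: le_trans (ler_norm _) _; near: n.
have Z_max_n w : (exists h, maximizer (loglik_ratio n q (v n) (Y ^~ w)) h) ->
  maximizer (loglik_ratio n q (v n) (Y ^~ w)) (Z n w) by move: w; near: n.
move=> w U_le; have U_r : eucl_norm (U n w) + e <= r by rewrite lerD2r.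
apply: (loglik_ratio_maximizer_near q01 iso_n v_le_n M0 e_gt0 U_r remainder_le).
apply: Z_max_n.
exact: (loglik_ratio_maximizer_exists q01 iso_n v_le_n M0 e_gt0 U_r remainder_le).
Unshelve. all: by end_near. Qed.

Theorem maximizer_cvg_dist_std_normal : cvg_dist_std_normal P Z.
Proof.
apply: (@cvg_dist_std_normal_trig _ _ _ _ _ U Z p%:R) score_cos_cvg
  maximizer_near_score.
- move=> n j; rewrite /U /score; under eq_fun do rewrite summxE.
  apply: measurable_sum => i; under eq_fun do rewrite mxE.
  by apply: measurable_funM => //; apply: measurable_funB.
- by move=> n; exact: (integrable_responses P Y_meas Y01
    (depends_below_score (fun u => eucl_norm u ^+ 2))).
near=> n; rewrite (@expect_score n (fun u => eucl_norm u ^+ 2) (fun=> 0)).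
by rewrite bern_mean_eucl_norm_score_sqr//; near: n.
Unshelve. all: by end_near. Qed.

End asymptotic_normality.

Theorem theorem5p2 (R : realType) (d : measure_display) (T : measurableType d)
  (P : probability T R) (p : nat)
  (x : nat -> 'cV[R]_p) (beta0 : 'cV[R]_p) (Y : nat -> T -> R)
  (betahat : nat -> T -> 'cV[R]_p) (Jhalf : nat -> 'M[R]_p) (n0 : nat) :
  let q := fun i => logistic (dotv beta0 (x i)) in
  let J := fun n => \sum_(i < n) (q i * (1 - q i)) *: (x i *m (x i)^T) in
  (* the responses: independent, {0,1}-valued, Pr{Y_i = 1} = q_i *)
  (forall i, measurable_fun setT (Y i)) ->
  (forall i w, Y i w = 0 \/ Y i w = 1) ->
  (forall i, P (Y i @^-1` [set 1]) = (q i)%:E) ->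
  mutually_independent_rv P Y ->
  (* betahat_n is the maximum likelihood estimator (a maximiser of the
     log-likelihood whenever one exists), measurable *)
  (forall n i j, measurable_fun setT (fun w => betahat n w i j)) ->
  (forall n w, (exists b, forall beta,
       loglik x n beta (fun i => Y i w) <= loglik x n b (fun i => Y i w)) ->
     forall beta,
       loglik x n beta (fun i => Y i w) <= loglik x n (betahat n w) (fun i => Y i w)) ->
  (* J_n invertible (for all large n), Jhalf n its symmetric square root *)
  (forall n, (n0 <= n)%N -> J n \in unitmx) ->
  (forall n, (n0 <= n)%N -> is_sym_sqrt (Jhalf n) (J n)) ->
  (* lambda_n = max_{i <= n} |J_n^{-1/2} x_i| is bounded *)
  (exists M : R, forall n i, (n0 <= n)%N -> (i < n)%N ->
      eucl_norm (invmx (Jhalf n) *m x i) <= M) ->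
  (* N_n(delta) -> 0 for each delta > 0 *)
  (forall delta : R, 0 < delta ->
     (fun n => \sum_(i < n)
        q i * (1 - q i) * ((x i)^T *m invmx (J n) *m x i) ord0 ord0
        * (if delta <= eucl_norm (invmx (Jhalf n) *m x i) then 1 else 0))
     @ \oo --> (0 : R)) ->
  (* conclusion: J_n^{1/2} (betahat_n - beta0) ->_d N_p{0, I_p} *)
  cvg_dist_std_normal P (fun n w => Jhalf n *m (betahat n w - beta0)).
Proof.
move=> q J Y_meas Y01 P_success Y_indep _ mle J_unit J_sqrt [M v_le] lindeberg.
pose v n i := invmx (Jhalf n) *m x i.
apply: (@maximizer_cvg_dist_std_normal _ _ _ P p q v `|M| Y) => //.
- exists n0 => // n /= n0_le_n.
  exact: isotropic_normalized (J_unit n n0_le_n) (J_sqrt n n0_le_n).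
- exists n0 => // n /= n0_le_n i i_n.
  exact: le_trans (v_le n i n0_le_n i_n) (ler_norm M).
- move=> e e_gt0; apply: cvg_trans (lindeberg e e_gt0); apply: near_eq_cvg.
  exists n0 => // n /= n0_le_n; apply: eq_bigr => i _.
  by rewrite (sym_sqrt_quadratic_form (J_unit n n0_le_n) (J_sqrt n n0_le_n)).
- exists n0 => // n /= n0_le_n w.
  by apply: (normalized_mle (J_unit n n0_le_n) (J_sqrt n n0_le_n)); exact: mle.
Qed.
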